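(* Let $q\in(0,2]$, $c\ge1$, and let $f,g:\mathbb{R}\to\mathbb{R}$ be continuous nondecreasing functions with $f$ positive. Let $a\in\mathbb{R}$ and let $\varphi$ be a maximal solution of the Cauchy problem $$\varphi''+\frac{c-1}{r}\varphi'=f(\varphi)+g(\varphi)|\varphi'|^q,\qquad \varphi(0)=a,\qquad \varphi'(0)=0 .$$ Then: \begin{itemize} \item[(i)] if $\lim_{t\to+\infty}g(t)>0$, then $\varphi$ is globally defined on $[0,+\infty)$ if and only if $$q\le1\quad\text{and}\quad\int_0^{+\infty}\frac{dt}{(t f(t))^{1/2}+(t g^+(t))^{1/(2-q)}}=+\infty ;$$ \item[(ii)] if $\lim_{t\to+\infty}g(t)\le0$, then $\varphi$ is globally defined on $[0,+\infty)$ if and only if $$\int_0^{+\infty}\frac{dt}{\left(\int_0^t e^{-2\int_s^t\left(\frac{g^-(\tau)}{f(\tau)}\right)^{2/q}f(\tau)\,d\tau}f(s)\,ds\right)^{1/2}}=+\infty ;$$ \item[(iii)] if $\lim_{t\to+\infty}g(t)<0$, then the condition in (ii) is equivalent to $$\int_0^{+\infty}\left[\frac{1}{(t f(t))^{1/2}}+\frac{1}{f(t)^{1/q}}\right]dt=+\infty .$$ \end{itemize}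
   Context: A solution of the Cauchy problem on $[0,R)$, $0<R\le+\infty$, is a function $\varphi\in C^2((0,R))\cap C([0,R))$ satisfying the ODE on $(0,R)$, $\varphi(0)=a$, $\lim_{r\to0^+}\varphi'(r)=0=\varphi'(0)$, and such that $\lim_{r\to0^+}\varphi''(r)$ exists in $\mathbb{R}$ (so the ODE also holds at $r=0$). A maximal solution is one defined on $[0,R)$ that cannot be extended to a solution on a larger interval. $g^+=\max(g,0)$, $g^-=\max(-g,0)$. *)

(* Defs.v *)
From HB Require Import structures.
From mathcomp Require Import all_boot all_order all_algebra.
From mathcomp Require Import all_classical all_reals all_analysis.
Set Implicit Arguments. Unset Strict Implicit. Unset Printing Implicit Defensive.
Import Order.TTheory GRing.Theory Num.Theory.
Import numFieldNormedType.Exports.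
Local Open Scope classical_set_scope.
Local Open Scope ring_scope.

Section Defs.
Variable R : realType.

Definition posp (g : R -> R) (t : R) : R := Num.max (g t) 0.
Definition negp (g : R -> R) (t : R) : R := Num.max (- g t) 0.

Definition is_solution (q c : R) (f g : R -> R) (a : R) (phi : R -> R)
  (Rr : \bar R) : Prop :=
  (0 < Rr)%E /\
  (forall r, 0 < r -> (r%:E < Rr)%E ->
     derivable phi r 1 /\ derivable (derive1 phi) r 1 /\
     {for r, continuous (derive1n 2 phi)}) /\
  (* phi in C([0,Rr)): continuity at 0 from the right (continuity on (0,Rr)
     follows from differentiability) *)
  (phi x @[x --> 0^'+] --> phi 0) /\
  (forall r, 0 < r -> (r%:E < Rr)%E ->
     derive1n 2 phi r + (c - 1) / r * derive1 phi r
       = f (phi r) + g (phi r) * (`|derive1 phi r| `^ q)) /\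
  phi 0 = a /\
  (derive1 phi r @[r --> 0^'+] --> 0) /\
  ((h^-1 * (phi h - phi 0)) @[h --> 0^'+] --> 0) /\
  (exists L : R, derive1n 2 phi r @[r --> 0^'+] --> L).

Definition is_maximal_solution (q c : R) (f g : R -> R) (a : R)
  (phi : R -> R) (Rr : \bar R) : Prop :=
  is_solution q c f g a phi Rr /\
  ~ (exists (psi : R -> R) (Rr' : \bar R),
       (Rr < Rr')%E /\ is_solution q c f g a psi Rr' /\
       (forall r, 0 <= r -> (r%:E < Rr)%E -> psi r = phi r)).

(* "int_0^{+oo} h(t) dt = +oo" for a nonnegative h, as a Lebesgue integral *)
Definition integral_diverges (h : R -> R) : Prop :=
  (\int[lebesgue_measure]_(t in `]0%R, +oo[) (h t)%:E = +oo)%E.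

(* int_a^b h for a <= b (continuous h), as a real number *)
Definition Rint (h : R -> R) (a b : R) : R :=
  fine (\int[lebesgue_measure]_(x in `[a, b]) (h x)%:E)%E.

Definition integrand_i (q : R) (f g : R -> R) (t : R) : R :=
  (Num.sqrt (t * f t) + (t * posp g t) `^ (1 / (2 - q)))^-1.

Definition integrand_ii (q : R) (f g : R -> R) (t : R) : R :=
  (Num.sqrt (Rint (fun s =>
      expR (- 2 * Rint (fun tau => (negp g tau / f tau) `^ (2 / q) * f tau) s t)
      * f s) 0 t))^-1.

Definition integrand_iii (q : R) (f : R -> R) (t : R) : R :=
  (Num.sqrt (t * f t))^-1 + (f t `^ q^-1)^-1.

End Defs.

(* Main.v *)
(** Along a solution v = phi' is positive, and blow-up can only happen by phi
    reaching +oo: for bounded phi the condition q <= 2 bounds v, and then the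
    solution continues past the endpoint. Hence, if P is a primitive of k,
    P(phi(r)) has derivative k(phi) v, and comparing v with 1 / k(phi) from above
    (resp. below) shows that phi is global if (resp. only if) k has infinite
    integral.

    When g becomes positive, upper bounds on v follow from the maximum of v on
    [r1, r]; lower bounds hold once v/r <= K (f(phi) + g(phi) v^q) with
    (c-1) K < 1, a relation that eventually holds and then persists.

    When g <= 0, v^2 is compared with the solution E of the linear equation
    E' = f - 2 (g^-/f)^(2/q) f E, E(0) = 0, whose square root is the denominator in (ii):
    with X = (g^-/f) v^q, the nonlinearity 1 - X and the linear term
    1 - X^(2/q) control each other. For (iii), E(2t) is comparable to the smaller
    of t f(t) and (f/g^-)^(2/q)(t). *)
Require Import Defs.
From HB Require Import structures.
From mathcomp Require Import all_boot all_order all_algebra.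
From mathcomp Require Import all_classical all_reals all_analysis.
From mathcomp Require Import measurable_realfun ring lra.
Import Order.TTheory GRing.Theory Num.Theory.
Import numFieldNormedType.Exports.
Local Open Scope classical_set_scope.
Local Open Scope ring_scope.
Set Implicit Arguments. Unset Strict Implicit. Unset Printing Implicit Defensive.

(** * Calculus, primitives and divergent integrals *)

Section Calculus.
Context {R : realType}.
Implicit Types (f g df dg dh : R -> R) (x y a b c d k : R).

(** Neither [f] nor [g] is Lipschitz, and for q < 1 the power is not Lipschitz at 0, so no Picard
    iteration can restart a solution at a finite endpoint. Positivity helps: the limit slope there
    is positive, so powers are Lipschitz near it, and an exponential weight makes the right-hand
    side nondecreasing in both unknowns. Monotonicity of [f] and [g] then replaces compactness.
    Friction is simply dropped in upper bounds; in lower bounds it competes with the source. When g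
    <= 0, integrating (r^(c-1) v)' from 0 gives v/r <= f(phi)/c, which leaves a margin f(phi)/c.
    When [g] is positive the source contains v^q and is not known to be monotone in r, so friction
    is controlled by a crossing argument that needs q <= 1. This is why q <= 1 is derived first,
    from the finite-time blow-up of v' >= const v^q with q > 1. Nothing bounds f(2t) by a multiple
    of f(t). Lower bounds are therefore proved at a level twice the one where [f] and [g] are
    evaluated, and the factor is removed by rescaling the variable in the divergent integral. *)

Lemma is_derive_add f g x a b : is_derive x 1 f a -> is_derive x 1 g b ->
  is_derive x 1 (fun y => f y + g y) (a + b).
Proof. exact: is_deriveD. Qed.

Lemma is_derive_sub f g x a b : is_derive x 1 f a -> is_derive x 1 g b ->
  is_derive x 1 (fun y => f y - g y) (a - b).
Proof. exact: is_deriveB. Qed.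

Lemma is_derive_mul f g x a b : is_derive x 1 f a -> is_derive x 1 g b ->
  is_derive x 1 (fun y => f y * g y) (f x * b + g x * a).
Proof. exact: is_deriveM. Qed.

Lemma is_derive_scale f k x a : is_derive x 1 f a ->
  is_derive x 1 (fun y => k * f y) (k * a).
Proof. exact: is_deriveZ. Qed.

Lemma is_derive_const k x : is_derive x 1 (fun _ : R => k) (0 : R).
Proof. exact: is_derive_cst. Qed.

Lemma is_derive_ident x : is_derive x 1 (fun y : R => y) 1.
Proof. exact: is_derive_id. Qed.

Lemma is_derive_sqr f x a : is_derive x 1 f a ->
  is_derive x 1 (fun y => f y ^+ 2) (2 * f x * a).
Proof.
move=> fa; have := is_derive_mul fa fa.
rewrite (_ : f x * a + f x * a = 2 * f x * a); last by ring.
by congr is_derive; apply/funext => y; rewrite expr2.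
Qed.

Lemma is_derive_chain f g x a b : is_derive (g x) 1 f a -> is_derive x 1 g b ->
  is_derive x 1 (fun y => f (g y)) (a * b).
Proof. exact: is_derive1_comp. Qed.

Lemma is_derive_continuous f x a : is_derive x 1 f a -> {for x, continuous f}.
Proof. by case=> df _; apply/differentiable_continuous/derivable1_diffP. Qed.

Lemma is_derive_derive1 f x a : is_derive x 1 f a -> derive1 f x = a.
Proof. by case=> _ <-; rewrite derive1E. Qed.

Lemma derivable_is_derive f x : derivable f x 1 -> is_derive x 1 f (derive1 f x).
Proof. by move=> df; split => //; rewrite derive1E. Qed.

Lemma derive_nonneg_le f df a b : a <= b ->
  (forall x, a <= x <= b -> is_derive x 1 f (df x)) ->
  (forall x, a < x < b -> 0 <= df x) -> f a <= f b.
Proof.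
rewrite le_eqVlt => /predU1P[-> //|ab] dfP df0.
have [||x xab fE] := @MVT R f df a b ab.
- by move=> x; rewrite in_itv/= => /andP[ax xb]; apply: dfP; rewrite !ltW.
- apply: continuous_in_subspaceT => x; rewrite inE/= in_itv/= => xab.
  exact: is_derive_continuous (dfP _ xab).
by rewrite -subr_ge0 fE mulr_ge0 ?subr_ge0 ?(ltW ab)// df0// -[_ < _ < _]in_itv.
Qed.

Lemma derive_nonpos_ge f df a b : a <= b ->
  (forall x, a <= x <= b -> is_derive x 1 f (df x)) ->
  (forall x, a < x < b -> df x <= 0) -> f b <= f a.
Proof.
move=> ab dfP df0; rewrite -lerN2.
apply: (@derive_nonneg_le (fun y => - f y) (fun y => - df y)) => // x xab.
  by have := dfP _ xab; exact: is_deriveN.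
by rewrite oppr_ge0 df0.
Qed.

Lemma derive_le_increment f df g dg a b : a <= b ->
  (forall x, a <= x <= b -> is_derive x 1 f (df x)) ->
  (forall x, a <= x <= b -> is_derive x 1 g (dg x)) ->
  (forall x, a < x < b -> df x <= dg x) -> f b - f a <= g b - g a.
Proof.
move=> ab fP gP fg.
have : g a - f a <= g b - f b.
  apply: (@derive_nonneg_le (fun y => g y - f y) (fun y => dg y - df y)) => // x xab.
    exact: is_derive_sub (gP _ xab) (fP _ xab).
  by rewrite subr_ge0 fg.
lra.
Qed.

Lemma derive_eq_increment f g dh a b : a <= b ->
  (forall x, a <= x <= b -> is_derive x 1 f (dh x)) ->
  (forall x, a <= x <= b -> is_derive x 1 g (dh x)) -> f b - f a = g b - g a.
Proof.
move=> ab fP gP; apply/eqP; rewrite eq_le.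
by rewrite !(@derive_le_increment _ dh _ dh).
Qed.

Lemma continuous_within_segment f a b :
  (forall x, a <= x <= b -> {for x, continuous f}) ->
  {within `[a, b], continuous f}.
Proof.
by move=> cf; apply: continuous_in_subspaceT => x; rewrite inE/= in_itv/= => /cf.
Qed.

Lemma continuous_near_gt f x a : {for x, continuous f} -> a < f x ->
  exists2 e, 0 < e & forall y, `|y - x| < e -> a < f y.
Proof.
move=> cf afx; have /cvgrPdist_lt/(_ (f x - a)) := cf.
rewrite subr_gt0 => /(_ afx) /nbhs_ballP[e/= e0 he].
exists e => // y yx; have /he : ball x e y by rewrite /ball/= distrC.
by rewrite /= => /ltr_normlW; lra.
Qed.

Lemma continuous_near_lt f x a : {for x, continuous f} -> f x < a ->
  exists2 e, 0 < e & forall y, `|y - x| < e -> f y < a.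
Proof.
move=> cf afx; have [| |e e0 he] := @continuous_near_gt (fun y => - f y) x (- a).
- exact: continuousN.
- by rewrite ltrN2.
by exists e => // y /he; rewrite ltrN2.
Qed.

(** The crossing point is the supremum of the points where [f] is nonpositive. Barrier arguments
    rest on it: after [s] the forbidden inequality is strict, at [s] it is an equality. *)
Lemma last_crossing f a b : a <= b ->
  (forall x, a <= x <= b -> {for x, continuous f}) -> f a <= 0 -> 0 < f b ->
  exists s, [/\ a <= s, s < b, f s = 0 & forall x, s < x <= b -> 0 < f x].
Proof.
move=> ab cf fa fb.
pose A := [set x | a <= x <= b /\ f x <= 0].
have supA : has_sup A.
  by split; [exists a; split; rewrite // lexx | exists b => x [/andP[]]].
set s := sup A.
have as_ : a <= s by apply: sup_upper_bound => //; split; rewrite // lexx.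
have sb : s <= b by apply: ge_sup; [case: supA | move=> x [/andP[]]].
have after x : s < x <= b -> 0 < f x.
  move=> /andP[sx xb]; rewrite ltNge; apply/negP => fx.
  have : x <= s by apply: sup_upper_bound => //; split; rewrite // xb (le_trans as_)// ltW.
  by rewrite leNgt sx.
have cfs := cf s; rewrite as_ sb in cfs.
have fs_le : f s <= 0.
  rewrite leNgt; apply/negP => fs.
  have [e e0 he] := continuous_near_gt (cfs isT) fs.
  have [x [/andP[ax xb] fx] sx] := sup_adherent e0 supA.
  have xs : x <= s by apply: sup_upper_bound => //; split; rewrite // ax.
  suff : 0 < f x by rewrite ltNge fx.
  by apply: he; rewrite ler0_norm ?subr_le0//; move: sx; rewrite -/s; lra.
have sltb : s < b.
  by rewrite lt_neqAle sb andbT; apply/eqP => sE; move: fs_le; rewrite sE leNgt fb.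
exists s; split => //; apply/eqP; rewrite eq_le fs_le leNgt; apply/negP => fs.
have [e e0 he] := continuous_near_lt (cfs isT) fs.
pose x := s + Num.min (e / 2) (b - s).
have m0 : 0 < Num.min (e / 2) (b - s) by rewrite lt_min divr_gt0//= subr_gt0.
have m1 : Num.min (e / 2) (b - s) <= e / 2 by rewrite ge_min lexx.
have m2 : Num.min (e / 2) (b - s) <= b - s by rewrite ge_min lexx orbT.
have : f x < 0 by apply: he; rewrite /x addrAC subrr add0r gtr0_norm//; lra.
by rewrite ltNge ltW// after// /x; lra.
Qed.

Lemma first_crossing f a b : a <= b ->
  (forall x, a <= x <= b -> {for x, continuous f}) -> 0 < f a -> f b <= 0 ->
  exists s, [/\ a < s, s <= b, f s = 0 & forall x, a <= x < s -> 0 < f x].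
Proof.
move=> ab cf fa fb.
have [| | | |s [s1 s2 s3 s4]] := @last_crossing (fun x => f (- x)) (- b) (- a).
- by rewrite lerN2.
- move=> x xab; apply: (@continuous_comp _ _ _ -%R f); first exact: opp_continuous.
  by apply: cf; lra.
- by rewrite opprK.
- by rewrite opprK.
exists (- s); split => //; [lra|lra|].
by move=> x xs; rewrite -[x]opprK s4//; lra.
Qed.

Lemma intermediate_value f a b v : a <= b ->
  (forall x, a <= x <= b -> {for x, continuous f}) -> f a <= v <= f b ->
  exists2 x, a <= x <= b & f x = v.
Proof.
move=> ab cf /andP[av vb].
have [| |x xab fx] := @IVT R f a b v ab; first exact: continuous_within_segment.
- by rewrite ge_min av/= le_max vb orbT.
- by exists x => //; rewrite -[_ <= _ <= _]in_itv.
Qed.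

(** The mean value theorem on either side of [x0] turns difference quotients at [x0] into values of
    [df] nearby. It gives differentiability where two solutions are glued. *)
Lemma is_derive_continuous_extension f df a b x0 : a < x0 < b ->
  (forall x, a < x < b -> x != x0 -> is_derive x 1 f (df x)) ->
  {for x0, continuous f} -> {for x0, continuous df} -> is_derive x0 1 f (df x0).
Proof.
move=> /andP[ax0 x0b] fP cf cdf.
suff H : h^-1 *: (f (h + x0) - f x0) @[h --> 0^'] --> df x0.
  have E : (fun h : R => h^-1 *: ((f \o shift x0) (h *: (1 : R)) - f x0)) =
           (fun h : R => h^-1 *: (f (h + x0) - f x0)).
    by apply/funext => h /=; rewrite [h *: 1]mulr1.
  split; first by rewrite /derivable E; apply/cvg_ex; exists (df x0).
  by rewrite /derive E; apply/cvg_lim.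
apply/cvgrPdist_lt => e e0.
have /cvgrPdist_lt/(_ e e0)/nbhs_ballP[d/= d0 hd] := cdf.
have [m [m0 md ma mb]] : exists m, [/\ 0 < m, m <= d, m <= x0 - a & m <= b - x0].
  exists (Num.min d (Num.min (x0 - a) (b - x0))).
  by rewrite !lt_min d0 !subr_gt0 ax0 x0b !ge_min !lexx !orbT.
exists m => //= h; rewrite /= sub0r normrN => hm h0.
have key y z : y < z -> x0 - m < y -> z < x0 + m -> (y = x0 \/ z = x0) ->
    exists2 w, `|w - x0| < m & f z - f y = df w * (z - y).
  move=> yz my zm yzx0.
  have [||w wyz fE] := @MVT R f df y z yz.
  - move=> w; rewrite in_itv/= => /andP[yw wz]; apply: fP; first by lra.
    by apply/eqP => wx; move: yw wz; rewrite wx; case: yzx0 => ->; rewrite ltxx.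
  - apply: continuous_within_segment => w /andP[yw wz].
    have [->//|wx] := eqVneq w x0.
    by apply: is_derive_continuous (fP _ _ wx); lra.
  exists w => //; move: wyz; rewrite in_itv/= => /andP[yw wz].
  by rewrite ltr_distl; lra.
have [w wm ->] : exists2 w, `|w - x0| < m & f (h + x0) - f x0 = df w * h.
  move: (hm); rewrite ltr_norml => /andP[h1 h2].
  have [hpos|hneg] := ltP 0 h.
    have [|||| w wm fE] := key x0 (h + x0); try by [lra | left].
    by exists w => //; rewrite fE addrK.
  have hlt : h < 0 by rewrite lt_neqAle h0 hneg.
  have [|||| w wm fE] := key (h + x0) x0; try by [lra | right].
  by exists w => //; rewrite -opprB fE; ring.
rewrite [_ *: _](_ : _ = df w); last by rewrite -[LHS]/(_ * _); field.
by apply: hd; rewrite /ball/= distrC (lt_le_trans wm).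
Qed.

End Calculus.

(** * Primitives, and divergence of integrals expressed through them *)

Section Primitives.
Context {R : realType}.
Notation mu := (@lebesgue_measure R).
Implicit Types (a b x y : R) (h P : R -> R).

(** An integral with fixed base point is a primitive only to the right of that point. The base [m x]
    therefore moves with x, below both x and 0, and the value at 0 is subtracted so that the choices
    agree. *)
Lemma continuous_has_primitive h : continuous h ->
  exists P, forall x, is_derive x 1 P (h x).
Proof.
move=> ch.
pose I b x := (\int[mu]_(t in `[b, x]) h t)%R.
have dI (b x : R) : b < x -> is_derive x 1 (I b) (h x).
  move=> bx; have [||||d e] := @continuous_FTC1_closed R h b x (x + 1).
  - by rewrite ltrDl.
  - apply: continuous_compact_integrable; first exact: segment_compact.
    exact: continuous_subspaceT.
  - exact: bx.
  - exact: ch.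
  by split; [exact: d | rewrite -derive1E].
pose m x := - (`|x| + 1); pose P x := I (m x) x - I (m x) 0.
have PE n y : n <= m y -> P y = I n y - I n 0.
  move=> nm; have my : m y < y by rewrite /m; case: ger0P; lra.
  have m0 : m y < 0 by rewrite /m; have := normr_ge0 y; lra.
  have H z1 z2 : z1 <= z2 -> m y < z1 -> I (m y) z2 - I (m y) z1 = I n z2 - I n z1.
    move=> z12 mz; apply: (derive_eq_increment (dh := h)) => // x /andP[xz _].
      by apply: dI; exact: lt_le_trans xz.
    by apply: dI; apply: le_lt_trans nm _; exact: lt_le_trans xz.
  have [y0|y0] := leP 0 y; first by rewrite /P H.
  by have := H y 0 (ltW y0) my; rewrite /P; lra.
exists P => x.
(* Around [x] the base can be frozen at [m x - 1], which lies below [m y] for every y at distance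
   less than 1. *)
have near_eq : {near x, (fun y => I (m x - 1) y - I (m x - 1) 0) =1 P}.
  apply/nbhs_ballP; exists 1 => //= y; rewrite /ball/= => xy.
  rewrite (PE (m x - 1))// /m; have : `|y| <= `|x| + `|x - y|.
    by rewrite -{1}[y](subKr x) (le_trans (ler_normB _ _)).
  by move: xy; lra.
have D : is_derive x 1 (fun y => I (m x - 1) y - I (m x - 1) 0) (h x).
  rewrite -[h x]subr0; apply: is_derive_sub (is_derive_const _ _).
  by apply: dI; rewrite /m; case: ger0P; lra.
have [d e] := D; split; first exact: near_eq_derivable d.
by rewrite -(near_eq_derive _ near_eq).
Qed.

Lemma integral_segment_primitive h P a b : a <= b ->
  (forall x, a <= x <= b -> {for x, continuous h}) ->
  (forall x, a <= x <= b -> is_derive x 1 P (h x)) ->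
  (\int[mu]_(x in `[a, b]) (h x)%:E = (P b - P a)%:E)%E.
Proof.
rewrite le_eqVlt => /predU1P[->|ab] ch dP.
  by rewrite subrr set_itv1 integral_set1.
rewrite (@continuous_FTC2 R h P a b)//; first exact: continuous_within_segment.
- have cP x : a <= x <= b -> {for x, continuous P}.
    by move=> /dP; exact: is_derive_continuous.
  split.
  + by move=> x; rewrite in_itv/= => /andP[ax xb]; have [|] := dP x; rewrite ?ltW.
  + by apply: cvg_at_right_filter; apply: cP; rewrite lexx ltW.
  + by apply: cvg_at_left_filter; apply: cP; rewrite lexx ltW.
- move=> x; rewrite in_itv/= => /andP[ax xb].
  by apply: is_derive_derive1; apply: dP; rewrite !ltW.
Qed.

Lemma Rint_primitive h P a b : a <= b -> continuous h ->
  (forall x, a <= x -> is_derive x 1 P (h x)) -> Defs.Rint h a b = P b - P a.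
Proof.
move=> ab ch dP; rewrite /Defs.Rint.
have dP' x : a <= x <= b -> is_derive x 1 P (h x) by move=> /andP[/dP].
by rewrite (integral_segment_primitive ab _ dP')// => x _; exact: ch.
Qed.

(** The integrands may be singular at 0, so the half-line is first mapped onto the real line by the
    substitution x = exp s. *)
Lemma pos_has_primitive h :
  (forall x, 0 < x -> {for x, continuous h}) ->
  exists P, forall x, 0 < x -> is_derive x 1 P (h x).
Proof.
move=> ch.
have [|Q dQ] := @continuous_has_primitive (fun s => h (expR s) * expR s).
  move=> s; apply: continuousM; last exact: continuous_expR.
  apply: (@continuous_comp _ _ _ expR h); first exact: continuous_expR.
  by apply: ch; exact: expR_gt0.
exists (fun x => Q (ln x)) => x x0.
have := is_derive_chain (dQ (ln x)) (is_derive1_ln x0).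
by rewrite lnK ?posrE// mulfK ?gt_eqF.
Qed.

(** Monotone convergence along compact intervals. The criterion sees divergence at 0 as well as at
    infinity, so its users must exclude the former separately. *)
Lemma integral_diverges_primitive h P :
  (forall x, 0 < x -> {for x, continuous h}) -> (forall x, 0 < x -> 0 <= h x) ->
  (forall x, 0 < x -> is_derive x 1 P (h x)) ->
  integral_diverges h <-> forall B, exists x y, [/\ 0 < x, x <= y & B < P y - P x].
Proof.
move=> ch h0 dP.
have mh : measurable_fun (`]0, +oo[ : set R) h.
  apply: open_continuous_measurable_fun.
    exact: interval_open.
  by move=> x; rewrite inE/= in_itv/= andbT => /ch.
have seg x y : 0 < x -> x <= y ->
    (\int[mu]_(t in `[x, y]) (h t)%:E = (P y - P x)%:E)%E.
  move=> x0 xy; apply: integral_segment_primitive => // t /andP[xt _].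
    by apply: ch; exact: lt_le_trans xt.
  by apply: dP; exact: lt_le_trans xt.
have sub x y : 0 < x -> `[x, y] `<=` (`]0, +oo[ : set R).
  by move=> x0 t /=; rewrite !in_itv/= andbT => /andP[xt _]; exact: lt_le_trans xt.
split=> [div B|unb].
- apply: contrapT => /forallNP noB.
  have bnd x y : 0 < x -> x <= y -> P y - P x <= B.
    move=> x0 xy; rewrite leNgt; apply/negP => BP.
    by apply: (noB x); exists y.
  (* These segments exhaust the open half-line and stay away from 0, where [P] is not controlled. *)
  pose F n : set R := `[n.+1%:R^-1, n.+1%:R]%classic.
  have FU : \bigcup_n F n = `]0, +oo[%classic.
    apply/seteqP; split=> [x [n _]|x].
      by apply: sub; rewrite invr_gt0 ltr0n.
    rewrite /= in_itv/= andbT => x0.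
    have [n xn] := ltr_add_invr x0; rewrite add0r in xn.
    have [k xk] : exists k, x < k%:R by exists (Num.truncn x).+1; exact: truncnS_gt.
    exists (maxn n k) => //; rewrite /F /= in_itv/=; apply/andP; split.
      apply: le_trans (ltW xn); rewrite lef_pV2 ?posrE ?ltr0n// ler_nat ltnS.
      exact: leq_maxl.
    apply: le_trans (ltW xk) _; rewrite ler_nat; apply: leqW; exact: leq_maxr.
  have : (\int[mu]_(x in F i) (h x)%:E @[i --> \oo] -->
          \int[mu]_(x in \bigcup_i F i) (h x)%:E)%E.
    apply: ge0_nondecreasing_set_cvg_integral.
    - apply/nondecreasing_seqP => n; rewrite subsetEset => x.
      rewrite /F /= !in_itv/= => /andP[h1 h2]; apply/andP; split.
        by apply: le_trans h1; rewrite lef_pV2 ?posrE ?ltr0n// ler_nat.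
      by apply: le_trans h2 _; rewrite ler_nat.
    - by move=> i; exact: measurable_itv.
    - by move=> i; apply/measurable_EFinP; apply: measurable_funS mh => //; apply: sub; rewrite invr_gt0 ltr0n.
    - move=> i x; rewrite /F /= in_itv/= lee_fin => /andP[ix _]; apply: h0.
      by apply: lt_le_trans ix; rewrite invr_gt0 ltr0n.
  rewrite FU => cv.
  have : (\int[mu]_(x in `]0%R, +oo[) (h x)%:E <= B%:E)%E.
    rewrite -(cvg_lim _ cv)//; apply: lime_le; first by apply/cvg_ex; eexists; exact: cv.
    apply: nearW => n; have n0 : 0 < n.+1%:R^-1 :> R by rewrite invr_gt0 ltr0n.
    have n1 : n.+1%:R^-1 <= n.+1%:R :> R.
      by apply: (@le_trans _ _ 1); [rewrite invf_le1 ?ltr0n// ler1n|rewrite ler1n].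
    by rewrite seg// lee_fin bnd.
  by rewrite div.
- rewrite /integral_diverges; apply/eqyP => B B0.
  have [x [y [x0 xy BP]]] := unb B.
  apply: (@le_trans _ _ (P y - P x)%:E); first by rewrite lee_fin ltW.
  rewrite -seg//; apply: ge0_subset_integral => //; last exact: sub.
    exact/measurable_EFinP.
  by move=> t; rewrite /= in_itv/= andbT lee_fin => /h0.
Qed.

End Primitives.

(** * Local existence *)

Section Continuity.
Context {R : realType}.
Implicit Types (f g : R -> R) (x a : R).

Lemma continuous_add f g x : {for x, continuous f} -> {for x, continuous g} ->
  {for x, continuous (fun y => f y + g y)}.
Proof. exact: continuousD. Qed.

Lemma continuous_sub f g x : {for x, continuous f} -> {for x, continuous g} ->
  {for x, continuous (fun y => f y - g y)}.
Proof. exact: continuousB. Qed.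

Lemma continuous_mul f g x : {for x, continuous f} -> {for x, continuous g} ->
  {for x, continuous (fun y => f y * g y)}.
Proof. exact: continuousM. Qed.

Lemma continuous_inv f x : f x != 0 -> {for x, continuous f} ->
  {for x, continuous (fun y => (f y)^-1)}.
Proof. exact: continuousV. Qed.

Lemma continuous_maxf f g x : {for x, continuous f} -> {for x, continuous g} ->
  {for x, continuous (fun y => Num.max (f y) (g y))}.
Proof. exact: continuous_max. Qed.

Lemma continuous_minf f g x : {for x, continuous f} -> {for x, continuous g} ->
  {for x, continuous (fun y => Num.min (f y) (g y))}.
Proof. exact: continuous_min. Qed.

Lemma continuous_const a x : {for x, continuous (fun _ : R => a)}.
Proof. exact: cst_continuous. Qed.

Lemma continuous_ident x : {for x, continuous (fun y : R => y)}.
Proof. by []. Qed.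

Lemma continuous_compf f g x : {for x, continuous g} -> {for g x, continuous f} ->
  {for x, continuous (fun y => f (g y))}.
Proof. exact: continuous_comp. Qed.

Lemma continuous_powR_gt0 f a x : {for x, continuous f} -> 0 < f x ->
  {for x, continuous (fun y => f y `^ a)}.
Proof.
move=> cf fx0; apply: (@continuous_compf (fun z => z `^ a)) => //.
exact: is_derive_continuous (is_derive1_powR a fx0).
Qed.

Lemma powR_invK a x : 0 < a -> 0 <= x -> (x `^ a^-1) `^ a = x.
Proof. by move=> a0 x0; rewrite -powRrM mulVf ?gt_eqF// powRr1. Qed.

(** The point is the case f x = 0, where the power need not be differentiable. Nonnegativity is
    required near [x] because [powR] has a conventional value on negative bases that does not tend
    to 0. *)
Lemma continuous_powR_ge0 f a x e : 0 < a -> {for x, continuous f} -> 0 < e ->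
  (forall y, `|y - x| < e -> 0 <= f y) -> {for x, continuous (fun y => f y `^ a)}.
Proof.
move=> a0 cf e0 f0; have : 0 <= f x by apply: f0; rewrite subrr normr0.
rewrite le_eqVlt => /predU1P[fx0|]; last exact: continuous_powR_gt0.
rewrite /prop_for /continuous_at -fx0 powR0 ?gt_eqF//.
apply/cvgrPdist_lt => k k0.
have ka : f x < k `^ a^-1 by rewrite -fx0 powR_gt0.
have [d d0 hd] := continuous_near_lt cf ka.
apply/nbhs_ballP; exists (Num.min e d); first by rewrite /= lt_min e0.
move=> y; rewrite /ball/= distrC lt_min => /andP[/f0 fy0 /hd fy].
rewrite sub0r normrN ger0_norm ?powR_ge0//.
rewrite -[k](powR_invK a0 (ltW k0)).
by apply: gt0_ltr_powR => //; rewrite nnegrE ?powR_ge0.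
Qed.

End Continuity.

Section LocalExistence.
Context {R : realType}.
Implicit Types (r x y : R) (h : R -> R).

(* The integral operator is monotone on the complete lattice of nondecreasing
   M-Lipschitz functions through (r0, B), so Knaster-Tarski yields a fixed point
   without any compactness or Lipschitz hypothesis. *)
Lemma monotone_system_solution (r0 A B M : R) (H : R -> R -> R -> R) (k : R -> R) :
  (forall r p u, 0 <= H r p u <= M) ->
  (forall r p p' u u', p <= p' -> u <= u' -> H r p u <= H r p' u') ->
  (forall p u : R -> R, continuous p -> continuous u ->
     continuous (fun r => H r (p r) (u r))) ->
  continuous k -> (forall r, 0 <= k r) ->
  exists p u, [/\ p r0 = A, u r0 = B & forall r, r0 <= r ->
    is_derive r 1 p (k r * u r) /\ is_derive r 1 u (H r (p r) (u r))].
Proof.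
move=> H0M Hmono Hcont ck k0.
have M0 : 0 <= M by have /andP[] := H0M 0 0 0; exact: le_trans.
(* [prim] selects the primitive vanishing at [r0]; its value on discontinuous functions is
   arbitrary. *)
have /boolp.choice[prim primP] : forall h, exists P : R -> R, continuous h ->
    (forall x, is_derive x 1 P (h x)) /\ P r0 = 0.
  move=> h.
  have [ch|nch] := pselect (continuous h); last by exists h.
  have [P dP] := continuous_has_primitive ch.
  exists (fun x => P x - P r0) => _; split; last by rewrite subrr.
  by move=> x; rewrite -[h x]subr0; exact: is_derive_sub (is_derive_const _ _).
have prim_le h1 h2 : continuous h1 -> continuous h2 ->
    (forall r, r0 <= r -> h1 r <= h2 r) ->
    forall r, r0 <= r -> prim h1 r <= prim h2 r.
  move=> c1 c2 h12 r r0r; have [d1 e1] := primP _ c1; have [d2 e2] := primP _ c2.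
  have : prim h1 r - prim h1 r0 <= prim h2 r - prim h2 r0.
    apply: (derive_le_increment r0r (fun x _ => d1 x) (fun x _ => d2 x)) => x.
    by move=> /andP[/ltW + _]; exact: h12.
  by rewrite e1 e2 !subr0.
pose L (u : R -> R) := u r0 = B /\ forall x y, x <= y -> 0 <= u y - u x <= M * (y - x).
have Lcont u : L u -> continuous u.
  move=> [_ uL] x; apply/cvgrPdist_le => e e0; apply/nbhs_ballP.
  have M1 : 0 < M + 1 by lra.
  exists (e / (M + 1)); first by rewrite /= divr_gt0.
  move=> y; rewrite /ball/= ltr_pdivlMr// => xy.
  have xyM : M * `|x - y| <= e.
    by apply: le_trans (ltW xy); rewrite mulrC ler_wpM2l// lerDl.
  have [le_xy|/ltW le_yx] := leP x y.
    have := uL _ _ le_xy; move: xyM; rewrite distrC ger0_norm ?subr_ge0// => ? ?.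
    by rewrite distrC ger0_norm; lra.
  have := uL _ _ le_yx; move: xyM; rewrite ger0_norm ?subr_ge0// => ? ?.
  by rewrite ger0_norm; lra.
pose phi (u : R -> R) r := A + prim (fun s => k s * u s) r.
pose T (u : R -> R) r := B + prim (fun s => H s (phi u s) (u s)) r.
have cku u : L u -> continuous (fun s => k s * u s).
  by move=> /Lcont cu x; apply: continuous_mul; [exact: ck|exact: cu].
have dphi u : L u -> forall r, is_derive r 1 (phi u) (k r * u r).
  move=> Lu r; have [dP _] := primP _ (cku _ Lu).
  by have := is_derive_add (is_derive_const A r) (dP r); rewrite add0r.
have cphi u : L u -> continuous (phi u).
  by move=> Lu r; exact: is_derive_continuous (dphi _ Lu r).
have cH u : L u -> continuous (fun s => H s (phi u s) (u s)).
  by move=> Lu; apply: Hcont; [exact: cphi|exact: Lcont].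
have dT u : L u -> forall r, is_derive r 1 (T u) (H r (phi u r) (u r)).
  move=> Lu r; have [dP _] := primP _ (cH _ Lu).
  by have := is_derive_add (is_derive_const B r) (dP r); rewrite add0r.
have LT u : L u -> L (T u).
  move=> Lu; split; first by rewrite /T (primP _ (cH _ Lu)).2 addr0.
  move=> x y xy; apply/andP; split.
    rewrite subr_ge0; apply: (derive_nonneg_le xy (fun r _ => dT _ Lu r)) => r _.
    by have /andP[] := H0M r (phi u r) (u r).
  rewrite mulrBr.
  apply: (@derive_le_increment R (T u) (fun r => H r (phi u r) (u r))
    (fun r => M * r) (fun=> M)) => // r _.
  - exact: dT.
  - by rewrite -[X in is_derive _ _ _ X]mulr1; apply: is_derive_scale; exact: is_derive_ident.
  - by have /andP[] := H0M r (phi u r) (u r).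
have Tmono u1 u2 : L u1 -> L u2 -> (forall r, r0 <= r -> u1 r <= u2 r) ->
    forall r, r0 <= r -> T u1 r <= T u2 r.
  move=> L1 L2 u12 r r0r; rewrite lerD2l; apply: (prim_le) => //; [exact: cH|exact: cH|].
  move=> s r0s; apply: Hmono; last exact: u12.
  rewrite lerD2l; apply: (prim_le) => //; [exact: cku|exact: cku|].
  by move=> t r0t; rewrite ler_wpM2l ?u12.
(* [S] is the set of post-fixed points of [T]. Their pointwise supremum [us] stays in [L] and
   satisfies us <= T us by monotonicity; then [T us] is itself in [S], which gives the converse
   inequality. *)
pose S (u : R -> R) := L u /\ forall r, r0 <= r -> u r <= T u r.
have SB : S (fun=> B).
  have LB : L (fun=> B).
    by split=> // x y xy; rewrite subrr lexx mulr_ge0 ?subr_ge0.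
  split=> // r r0r; have [TB Tinc] := LT _ LB.
  by have /andP[+ _] := Tinc _ _ r0r; rewrite TB subr_ge0.
pose V r := [set u r | u in S].
have Lbound u r : L u -> u r <= B + M * `|r - r0|.
  move=> [ur0 uL]; have [rr0|/ltW rr0] := leP r0 r.
    by have := uL _ _ rr0; rewrite ger0_norm ?subr_ge0// ur0; lra.
  have := uL _ _ rr0; rewrite ur0 => ?.
  have : 0 <= M * `|r - r0| by exact: mulr_ge0.
  lra.
have supV r : has_sup (V r).
  split; first by exists B; exists (fun=> B).
  by exists (B + M * `|r - r0|) => _ [u [Lu _] <-]; exact: Lbound.
pose us r := sup (V r).
have us_ub u : S u -> forall r, u r <= us r.
  by move=> Su r; apply: sup_upper_bound; [exact: supV|exists u].
have us_least r z : (forall u, S u -> u r <= z) -> us r <= z.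
  by move=> uz; apply: ge_sup; [case: (supV r)|move=> _ [u Su <-]; exact: uz].
have Lus : L us.
  split.
    apply/eqP; rewrite eq_le (us_ub _ SB) andbT.
    by apply: us_least => u [[-> _] _].
  move=> x y xy; apply/andP; split.
    rewrite subr_ge0; apply: us_least => u Su; apply: le_trans (us_ub _ Su y).
    by have [[_ uL] _] := Su; have /andP[+ _] := uL _ _ xy; rewrite subr_ge0.
  rewrite lerBlDr; apply: us_least => u Su.
  have [[_ uL] _] := Su; have /andP[_] := uL _ _ xy.
  by have := us_ub _ Su x; lra.
have us_le_T r : r0 <= r -> us r <= T us r.
  move=> r0r; apply: us_least => u Su; have [Lu uT] := Su.
  apply: le_trans (uT _ r0r) _; apply: Tmono => // s _; exact: us_ub.
have T_le_us r : T us r <= us r.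
  by apply: us_ub; split; [exact: LT|apply: Tmono => //; exact: LT].
have usE r : r0 <= r -> us r = T us r.
  by move=> r0r; apply/eqP; rewrite eq_le us_le_T// T_le_us.
exists (phi us), (T us); split.
- by rewrite /phi (primP _ (cku _ Lus)).2 addr0.
- by have [] := LT _ Lus.
- by move=> r r0r; rewrite -usE//; split; [exact: dphi|exact: dT].
Qed.

(** Writing the slope q z^(q-1) as q z^q / z bounds it by q hi^q / lo for q below and above 1
    alike. *)
Lemma powR_lipschitz (q lo hi x y : R) : 0 < q -> 0 < lo ->
  lo <= x -> x <= y -> y <= hi ->
  y `^ q - x `^ q <= q * hi `^ q / lo * (y - x).
Proof.
move=> q0 lo0 lox xy yhi; rewrite mulrBr.
apply: (@derive_le_increment R (fun z => z `^ q) (fun z => q * z `^ (q - 1))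
  (fun z => q * hi `^ q / lo * z) (fun=> q * hi `^ q / lo)) => // z.
- by move=> /andP[xz _]; apply: is_derive1_powR; lra.
- move=> _; rewrite -[X in is_derive _ _ _ X]mulr1.
  by apply: is_derive_scale; exact: is_derive_ident.
- move=> /andP[xz zy]; have z0 : 0 < z by lra.
  rewrite powRB; last by apply/implyP => _; rewrite gt_eqF.
  rewrite powRr1 ?(ltW z0)// mulrA.
  rewrite ler_pM ?mulr_ge0 ?powR_ge0 ?invr_ge0 ?(ltW q0) ?(ltW z0)//.
    rewrite ler_wpM2l ?(ltW q0)//; apply: ge0_ler_powR; rewrite ?nnegrE; lra.
  by rewrite lef_pV2 ?posrE//; lra.
Qed.

(** Friction and a negative [g] make the right-hand side decrease in v. Clipping the variables makes
    this decrease Lipschitz, and passing to u = exp(K (r - r0)) v adds a term K v that outweighs it,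
    so the monotone fixed-point lemma applies to u. *)
Lemma local_solution (q c : R) (f g : R -> R) (r0 A B : R) :
  0 < q -> 1 <= c ->
  continuous f -> {homo f : x y / x <= y} -> (forall t, 0 < f t) ->
  continuous g -> {homo g : x y / x <= y} ->
  0 < r0 -> 0 < B ->
  exists p v e, [/\ 0 < e, p r0 = A, v r0 = B & forall r, r0 <= r < r0 + e ->
    [/\ 0 < v r, is_derive r 1 p (v r) &
        is_derive r 1 v (f (p r) + g (p r) * v r `^ q - (c - 1) / r * v r)]].
Proof.
move=> q0 c1 cf mf f0 cg mg r00 B0.
pose clip lo hi x : R := Num.max lo (Num.min x hi).
have clip_lo lo hi x : lo <= clip lo hi x by rewrite /clip le_max lexx.
have clip_hi lo hi x : lo <= hi -> clip lo hi x <= hi.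
  by move=> lohi; rewrite /clip ge_max lohi ge_min lexx orbT.
have clip_mono lo hi x y : x <= y -> clip lo hi x <= clip lo hi y.
  move=> xy; rewrite /clip ge_max !le_max lexx/=; apply/orP; right.
  by rewrite le_min !ge_min xy lexx orbT.
have clip_id lo hi x : lo <= x <= hi -> clip lo hi x = x.
  by move=> /andP[lox xhi]; rewrite /clip (min_l xhi) (max_r lox).
have clip_cont lo hi (h : R -> R) x : {for x, continuous h} ->
    {for x, continuous (fun y => clip lo hi (h y))}.
  move=> ch; apply: continuous_maxf; first exact: continuous_const.
  by apply: continuous_minf => //; exact: continuous_const.
(* The slope is kept between B/2 and 2B, hence away from 0, where the power may fail to be
   Lipschitz. *)
pose lo := B / 2; pose hi := 2 * B.
have lo0 : 0 < lo by rewrite /lo; lra.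
have lohi : lo <= hi by rewrite /lo /hi; lra.
pose rho := clip r0 (r0 + 1); pose cv := clip lo hi; pose cp := clip (A - 1) (A + 1).
have rho0 r : r0 <= rho r by exact: clip_lo.
have rho1 r : rho r <= r0 + 1 by apply: clip_hi; lra.
have cv_lo x : lo <= cv x by exact: clip_lo.
have cv_hi x : cv x <= hi by exact: clip_hi.
pose G := `|g (A - 1)|; pose G' := `|g (A + 1)|.
have G0 : 0 <= G by exact: normr_ge0.
have g_lo x : - G <= g (cp x).
  apply: le_trans (mg _ _ (clip_lo _ _ _)).
  by rewrite /G lerNl; have := ler_norm (- g (A - 1)); rewrite normrN.
have g_hi x : g (cp x) <= G'.
  apply: le_trans (ler_norm _); apply: mg; apply: clip_hi; lra.
(* [K1] compensates the decrease of g v^q, [K2] that of friction; [K3] makes [In] nonnegative, as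
   the fixed-point lemma requires. *)
pose K1 := G * (q * hi `^ q / lo); pose K2 := (c - 1) / r0; pose K3 := G * hi `^ q / lo.
have hiq0 : 0 <= hi `^ q by exact: powR_ge0.
have K10 : 0 <= K1.
  by rewrite /K1 mulr_ge0// divr_ge0 ?(ltW lo0)// mulr_ge0 ?(ltW q0).
have K20 : 0 <= K2 by rewrite /K2 divr_ge0 ?(ltW r00)// subr_ge0.
have K30 : 0 <= K3 by rewrite /K3 divr_ge0 ?(ltW lo0)// mulr_ge0.
pose K := K1 + K2 + K3; have K0 : 0 <= K by rewrite /K; lra.
have fric r : 0 <= (c - 1) / rho r <= K2.
  have rr := lt_le_trans r00 (rho0 r).
  rewrite divr_ge0 ?subr_ge0 ?(ltW rr)//=.
  by rewrite /K2 ler_wpM2l ?subr_ge0// lef_pV2 ?posrE.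
have cvq x : cv x `^ q <= hi `^ q.
  by apply: ge0_ler_powR; rewrite ?nnegrE ?(ltW q0)//; have := cv_lo x; have := cv_hi x; lra.
pose E r := expR (K * (rho r - r0)).
have E0 r : 0 < E r by exact: expR_gt0.
pose In r p v := f (cp p) + g (cp p) * cv v `^ q - (c - 1) / rho r * cv v + K * cv v.
have In_mono r p p' v v' : p <= p' -> v <= v' -> In r p v <= In r p' v'.
  move=> pp vv.
  have fp : f (cp p) <= f (cp p') by exact/mf/clip_mono.
  have gp : g (cp p) <= g (cp p') by exact/mg/clip_mono.
  have cvv : cv v <= cv v' by exact: clip_mono.
  have pw : cv v' `^ q - cv v `^ q <= q * hi `^ q / lo * (cv v' - cv v).
    by apply: powR_lipschitz => //.
  have pw0 : cv v `^ q <= cv v' `^ q.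
    by apply: ge0_ler_powR; rewrite ?nnegrE ?(ltW q0)//; have := cv_lo v; have := cv_lo v'; lra.
  have s1 : g (cp p) * cv v' `^ q <= g (cp p') * cv v' `^ q.
    by rewrite ler_wpM2r ?powR_ge0.
  have s2 : - (K1 * (cv v' - cv v)) <= g (cp p) * (cv v' `^ q - cv v `^ q).
    apply: (@le_trans _ _ (- G * (cv v' `^ q - cv v `^ q))).
      by rewrite mulNr lerN2 /K1 -mulrA ler_wpM2l.
    by rewrite ler_wpM2r ?g_lo// subr_ge0.
  have s3 : (c - 1) / rho r * (cv v' - cv v) <= K2 * (cv v' - cv v).
    by rewrite ler_wpM2r ?subr_ge0//; have /andP[] := fric r.
  have s4 : 0 <= K3 * (cv v' - cv v) by rewrite mulr_ge0 ?subr_ge0.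
  by move: s1 s2 s3 s4 fp; rewrite /In /K; nra.
have In_ge0 r p v : 0 <= In r p v.
  have fp := f0 (cp p); have v0 : 0 < cv v by have := cv_lo v; lra.
  have s1 : - (G * hi `^ q) <= g (cp p) * cv v `^ q.
    apply: (@le_trans _ _ (- G * cv v `^ q)).
      by rewrite mulNr lerN2 ler_wpM2l.
    by rewrite ler_wpM2r ?g_lo ?powR_ge0.
  have s2 : (c - 1) / rho r * cv v <= K2 * cv v.
    by rewrite ler_wpM2r ?(ltW v0)//; have /andP[] := fric r.
  have s3 : G * hi `^ q <= K3 * cv v.
    rewrite /K3 -mulrA ler_peMr ?mulr_ge0//.
    by rewrite mulrC ler_pdivlMr// mul1r.
  have s4 : 0 <= K1 * cv v by rewrite mulr_ge0 ?(ltW v0).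
  by move: s1 s2 s3 s4 fp; rewrite /In /K; nra.
pose M := expR K * (f (A + 1) + G' * hi `^ q + K * hi).
have In_le r p v : E r * In r p v <= M.
  apply: ler_pM => //; first exact: ltW.
    rewrite /E ler_expR -[leRHS]mulr1 ler_wpM2l//.
    by have := rho1 r; lra.
  have fp : f (cp p) <= f (A + 1) by apply: mf; apply: clip_hi; lra.
  have v0 : 0 < cv v by have := cv_lo v; lra.
  have s1 : g (cp p) * cv v `^ q <= G' * hi `^ q.
    apply: (@le_trans _ _ (G' * cv v `^ q)); first by rewrite ler_wpM2r ?powR_ge0.
    by rewrite ler_wpM2l// /G' normr_ge0.
  have s2 : 0 <= (c - 1) / rho r * cv v.
    by rewrite mulr_ge0 ?(ltW v0)//; have /andP[] := fric r.
  have s3 : K * cv v <= K * hi by rewrite ler_wpM2l.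
  by move: s1 s2 s3 fp; rewrite /In; lra.
pose k r := expR (- K * (r - r0)).
pose H r p u := E r * In r p ((E r)^-1 * u).
have cE x : {for x, continuous E}.
  apply: (@continuous_compf R expR); last exact: continuous_expR.
  apply: continuous_mul; first exact: continuous_const.
  apply: continuous_sub; last exact: continuous_const.
  exact: clip_cont.
have ck : continuous k.
  move=> x; suff : {for x, continuous k} by [].
  apply: (@continuous_compf R expR); last exact: continuous_expR.
  apply: continuous_mul; first exact: continuous_const.
  apply: continuous_sub; last exact: continuous_const.
  exact: continuous_ident.
have [] := @monotone_system_solution r0 A B M H k.
- by move=> r p u; rewrite In_le mulr_ge0// ltW.
- move=> r p p' u u' pp uu; rewrite /H ler_wpM2l ?(ltW (E0 r))//.
  by apply: In_mono => //; rewrite ler_wpM2l// invr_ge0 ltW.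
- move=> p u cpp cu x; apply: continuous_mul; first exact: cE.
  have cvv : {for x, continuous (fun y => cv ((E y)^-1 * u y))}.
    apply: clip_cont; apply: continuous_mul; last exact: cu.
    by apply: continuous_inv; [rewrite gt_eqF|exact: cE].
  have cpc : {for x, continuous (fun y => cp (p y))} by apply: clip_cont; exact: cpp.
  apply: continuous_add; last first.
    by apply: continuous_mul => //; exact: continuous_const.
  apply: continuous_sub; last first.
    apply: continuous_mul => //; apply: continuous_mul; first exact: continuous_const.
    apply: continuous_inv; first by rewrite gt_eqF// (lt_le_trans r00).
    exact: clip_cont.
  apply: continuous_add; first by apply: continuous_compf => //; exact: cf.
  apply: continuous_mul; first by apply: continuous_compf => //; exact: cg.
  by apply: continuous_powR_gt0 => //; apply: lt_le_trans (cv_lo _).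
- exact: ck.
- by move=> r; rewrite ltW// expR_gt0.
move=> p [u [pA uB pu]].
pose v r := k r * u r.
have dk r : is_derive r 1 k (k r * (- K)).
  apply: is_derive_chain.
  have := is_derive_scale (- K) (is_derive_sub (is_derive_ident r) (is_derive_const r0 r)).
  by rewrite subr0 mulr1.
have dp r : r0 <= r -> is_derive r 1 p (v r) by move=> /pu[].
have dv r : r0 <= r -> is_derive r 1 v (k r * H r (p r) (u r) + u r * (k r * - K)).
  by move=> r0r; apply: (is_derive_mul (dk r)); have [] := pu _ r0r.
have vB : v r0 = B by rewrite /v uB /k subrr mulr0 expR0 mul1r.
have cp0 := is_derive_continuous (dp _ (lexx r0)).
have cv0 := is_derive_continuous (dv _ (lexx r0)).
(* By continuity at [r0], none of the clips is active on a short interval, so there the clipped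
   system is the original one. *)
have [|e1 e10 he1] := @continuous_near_gt R p r0 (A - 1) cp0; first by rewrite pA; lra.
have [|e2 e20 he2] := @continuous_near_lt R p r0 (A + 1) cp0; first by rewrite pA; lra.
have [|e3 e30 he3] := @continuous_near_gt R v r0 lo cv0; first by rewrite vB /lo; lra.
have [|e4 e40 he4] := @continuous_near_lt R v r0 hi cv0; first by rewrite vB /hi; lra.
pose e := Num.min (Num.min e1 e2) (Num.min (Num.min e3 e4) 1).
have e0 : 0 < e by rewrite /e !lt_min e10 e20 e30 e40 ltr01.
have [ee1 ee2 ee3 ee4 ee5] : [/\ e <= e1, e <= e2, e <= e3, e <= e4 & e <= 1].
  by rewrite /e !ge_min !lexx !orbT.
exists p, v, e; split; [exact: e0|exact: pA|exact: vB|].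
move=> r /andP[r0r rre].
have rr : `|r - r0| < e by rewrite ger0_norm ?subr_ge0// ltrBlDl.
have p1 := he1 _ (lt_le_trans rr ee1); have p2 := he2 _ (lt_le_trans rr ee2).
have v1 := he3 _ (lt_le_trans rr ee3); have v2 := he4 _ (lt_le_trans rr ee4).
split; [exact: lt_trans v1|exact: dp|].
have rhoE : rho r = r.
  by apply: clip_id; rewrite r0r/= ltW// (lt_le_trans rre)// lerD2l.
have kE : k r = (E r)^-1 by rewrite /E rhoE /k mulNr expRN.
have := dv _ r0r; congr is_derive.
have cvE : cv (v r) = v r by apply: clip_id; rewrite !ltW.
have cpE : cp (p r) = p r by apply: clip_id; rewrite !ltW.
rewrite /H -kE -/(v r) /In rhoE cvE cpE.
rewrite mulrA kE mulVf ?gt_eqF// mul1r /v kE.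
by ring.
Qed.

End LocalExistence.

(** * Positivity and continuation of solutions *)

Section Solutions.
Context {R : realType} (q c : R) (f g : R -> R) (a : R).
Context (q_gt0 : 0 < q) (q_le2 : q <= 2) (c_ge1 : 1 <= c).
Context (f_cont : continuous f) (f_ndecr : {homo f : x y / x <= y}).
Context (f_gt0 : forall t, 0 < f t).
Context (g_cont : continuous g) (g_ndecr : {homo g : x y / x <= y}).
Implicit Types (r s x y e : R).

Let rhs (p v : R -> R) r := f (p r) + g (p r) * v r `^ q - (c - 1) / r * v r.

Lemma derive_gt0_left (h : R -> R) s d : is_derive s 1 h d -> 0 < d ->
  exists2 e, 0 < e & forall x, s - e < x < s -> h x < h s.
Proof.
move=> /is_derive1_caratheodory[k [hE ck ks]] d0.
have [|e e0 he] := @continuous_near_gt R k s 0 ck; first by rewrite ks.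
exists e => // x /andP[ex xs]; rewrite -subr_lt0 hE pmulr_rlt0 ?subr_lt0//.
by apply: he; rewrite ltr0_norm ?subr_lt0//; lra.
Qed.

(** Divergence form of the radial operator: r^(c-1) is the integrating factor of friction. *)
Lemma powR_friction_derive (v h : R -> R) r : 0 < r ->
  is_derive r 1 v (h r - (c - 1) / r * v r) ->
  is_derive r 1 (fun s => s `^ (c - 1) * v s) (r `^ (c - 1) * h r).
Proof.
move=> r0 dv; have := is_derive_mul (is_derive1_powR (c - 1) r0) dv.
have -> : r `^ (c - 1 - 1) = r `^ (c - 1) / r.
  rewrite powRB; last by apply/implyP => _; rewrite gt_eqF.
  by rewrite powRr1 ?(ltW r0).
by congr is_derive; field; rewrite gt_eqF.
Qed.

Lemma at_right_near (h : R -> R) (l : R) e : h x @[x --> 0^'+] --> l -> 0 < e ->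
  exists2 d, 0 < d & forall x, 0 < x < d -> `|h x - l| < e.
Proof.
move=> /cvgrPdist_lt hl e0; have [d /= d0 hd] := hl _ e0.
exists d => // x /andP[x0 xd]; rewrite distrC; apply: hd => //=.
by rewrite sub0r normrN gtr0_norm.
Qed.

Section Solution.
Context (phi : R -> R) (Rr : \bar R) (sol : is_solution q c f g a phi Rr).
Let v := derive1 phi.

Lemma solution_gt0 : (0 < Rr)%E. Proof. by case: sol. Qed.

Lemma solution_derive r : 0 < r -> (r%:E < Rr)%E -> is_derive r 1 phi (v r).
Proof.
move=> r0 rR; apply: derivable_is_derive.
by case: sol => _ [/(_ r r0 rR)[]].
Qed.

Lemma solution_derive2_abs r : 0 < r -> (r%:E < Rr)%E ->
  is_derive r 1 v (f (phi r) + g (phi r) * `|v r| `^ q - (c - 1) / r * v r).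
Proof.
move=> r0 rR; case: sol => _ [/(_ r r0 rR)[_ [dv _]] [_ [/(_ r r0 rR) ode _]]].
by rewrite -ode; have := derivable_is_derive dv; congr is_derive; rewrite /v/=; lra.
Qed.

Lemma solution_near0 e : 0 < e -> exists2 d, 0 < d & forall r, 0 < r < d ->
  `|phi r - a| < e /\ `|v r| < e.
Proof.
move=> e0; case: sol => _ [_ [cphi [_ [phi0 [v0 _]]]]].
rewrite phi0 in cphi.
have [d1 d10 h1] := at_right_near cphi e0; have [d2 d20 h2] := at_right_near v0 e0.
exists (Num.min d1 d2); first by rewrite lt_min d10.
move=> r; rewrite lt_min => /andP[r0 /andP[r1 r2]].
split; first by apply: h1; rewrite r0.
by have := h2 r; rewrite r0 subr0; exact.
Qed.

Lemma ereal_lt_min_exists d : 0 < d -> exists r, [/\ 0 < r, r < d & (r%:E < Rr)%E].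
Proof.
move=> d0; have := solution_gt0; case: Rr => [s| |]//; last first.
  by move=> _; exists (d / 2); split; [lra|lra|rewrite ltry].
rewrite lte_fin => s0; exists (Num.min d s / 2).
have m0 : 0 < Num.min d s by rewrite lt_min d0.
have m1 : Num.min d s <= d by rewrite ge_min lexx.
have m2 : Num.min d s <= s by rewrite ge_min lexx orbT.
by split; rewrite ?lte_fin; lra.
Qed.

Lemma ereal_ltW s r : s <= r -> (r%:E < Rr)%E -> (s%:E < Rr)%E.
Proof. by move=> sr; apply: le_lt_trans; rewrite lee_fin. Qed.

Lemma friction_weight_near0 e : 0 < e -> exists2 d, 0 < d & forall r, 0 < r < d ->
  `|r `^ (c - 1) * v r| < e.
Proof.
move=> e0; have [d d0 hd] := solution_near0 e0.
exists (Num.min d 1); first by rewrite lt_min d0/=.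
move=> r; rewrite lt_min => /andP[r0 /andP[rd r1]].
have [|_ vr] := hd r; first by rewrite r0.
apply: le_lt_trans vr; rewrite normrM ger0_norm ?powR_ge0// ler_piMl//.
rewrite -[leRHS](powRr0 r); apply: ger_powR; last by rewrite subr_ge0.
by rewrite r0 ltW.
Qed.

Lemma solution_rhs_gt0_near0 : exists2 d, 0 < d & forall r, 0 < r < d ->
  0 < f (phi r) + g (phi r) * `|v r| `^ q.
Proof.
pose m := f (a - 1); have m0 : 0 < m by exact: f_gt0.
pose G := `|g (a - 1)| + 1.
have G0 : 0 < G by rewrite /G; have := normr_ge0 (g (a - 1)); lra.
have mG : 0 < m / G by rewrite divr_gt0.
(* The bound 1 keeps phi above a - 1, so that f(phi) >= m and g(phi) > -G; the other bound gives G
   |v|^q < m. *)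
pose e := Num.min 1 ((m / G) `^ q^-1).
have e0 : 0 < e by rewrite lt_min ltr01 powR_gt0.
have [d d0 hd] := solution_near0 e0; exists d => // r /hd[h1 h2].
have e1 : e <= 1 by rewrite ge_min lexx.
have pa : a - 1 <= phi r by move: h1; rewrite ltr_norml => /andP[]; lra.
have fm : m <= f (phi r) by exact: f_ndecr.
have gG : - G < g (phi r).
  apply: lt_le_trans (g_ndecr pa); rewrite /G.
  by have := ler_norm (- g (a - 1)); rewrite normrN; lra.
have vq : `|v r| `^ q < m / G.
  rewrite -[ltRHS](powR_invK q_gt0 (ltW mG)).
  apply: gt0_ltr_powR => //; rewrite ?nnegrE ?powR_ge0//.
  by apply: lt_le_trans h2 _; rewrite ge_min lexx orbT.
have vq0 : 0 <= `|v r| `^ q by exact: powR_ge0.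
rewrite ltr_pdivlMr// in vq; nra.
Qed.

(** At a zero of [v] the equation reads v' = f(phi) > 0, so [v] is negative just before it; hence
    [v] cannot return to 0 from positive values. Positivity near the origin comes from the
    divergence form. *)
Lemma solution_derive_gt0 r : 0 < r -> (r%:E < Rr)%E -> 0 < v r.
Proof.
move=> r0 rR.
have pos_zero s : 0 < s -> (s%:E < Rr)%E -> v s = 0 ->
    exists2 e, 0 < e & forall x, s - e < x < s -> v x < 0.
  move=> s0 sR vs; have := solution_derive2_abs s0 sR.
  rewrite vs normr0 powR0 ?gt_eqF// !mulr0 subr0 addr0 => dv.
  have [e e0 he] := derive_gt0_left dv (f_gt0 _).
  by exists e => // x /he; rewrite vs.
have [d d0 hd] := solution_rhs_gt0_near0.
pose y s := s `^ (c - 1) * v s.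
(* Near 0 the function [y] is nondecreasing and tends to 0, so a negative value at [s] would
   contradict the limit. *)
have y_ge0 s : 0 < s < d -> (s%:E < Rr)%E -> 0 <= v s.
  move=> /andP[s0 sd] sR.
  suff : 0 <= y s by rewrite /y pmulr_rge0// powR_gt0.
  rewrite leNgt; apply/negP => ys.
  have [|d1 d10 hd1] := @friction_weight_near0 (- y s); first by rewrite oppr_gt0.
  pose t := Num.min d1 s / 2.
  have m0 : 0 < Num.min d1 s by rewrite lt_min d10.
  have m1 : Num.min d1 s <= d1 by rewrite ge_min lexx.
  have m2 : Num.min d1 s <= s by rewrite ge_min lexx orbT.
  have [t0 td1 ts] : [/\ 0 < t, t < d1 & t < s] by rewrite /t; split; lra.
  have : y t <= y s.
    apply: (@derive_nonneg_le R y (fun x => x `^ (c - 1) *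
      (f (phi x) + g (phi x) * `|v x| `^ q))); first exact: ltW.
    - move=> x /andP[tx xs]; have x0 : 0 < x by lra.
      apply: (powR_friction_derive (h := fun x => f (phi x) + g (phi x) * `|v x| `^ q)) => //.
      by apply: solution_derive2_abs => //; exact: ereal_ltW sR.
    - move=> x /andP[tx xs]; rewrite mulr_ge0 ?powR_ge0// ltW// hd//; lra.
  have := hd1 t; rewrite t0 td1 => /(_ isT); rewrite -/(y t) ltr_norml => /andP[].
  lra.
have v_pos0 s : 0 < s < d -> (s%:E < Rr)%E -> 0 < v s.
  move=> sd sR; rewrite lt_neqAle y_ge0// andbT eq_sym; apply/eqP => vs.
  have /andP[s0 sd'] := sd.
  have [e e0 he] := pos_zero _ s0 sR vs.
  pose x := s - Num.min e s / 2.
  have m0 : 0 < Num.min e s by rewrite lt_min e0.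
  have m1 : Num.min e s <= e by rewrite ge_min lexx.
  have m2 : Num.min e s <= s by rewrite ge_min lexx orbT.
  have : v x < 0 by apply: he; rewrite /x; lra.
  rewrite ltNge y_ge0//; first by rewrite /x; lra.
  by apply: ereal_ltW sR; rewrite /x; lra.
have [s [s0 sd sR]] := ereal_lt_min_exists d0.
have vs : 0 < v s by apply: v_pos0 => //; rewrite s0.
rewrite ltNge; apply/negP => vr.
have sr : s <= r.
  rewrite leNgt; apply/negP => rs; move: vr; rewrite leNgt v_pos0//; lra.
have [|z [sz zr vz vpos]] := @first_crossing R v s r sr _ vs vr.
  move=> x /andP[sx xr]; apply: is_derive_continuous (solution_derive2_abs _ _).
    exact: lt_le_trans sx.
  exact: ereal_ltW rR.
have z0 : 0 < z by exact: lt_trans sz.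
have [e e0 he] := pos_zero _ z0 (ereal_ltW zr rR) vz.
pose x := z - Num.min e (z - s) / 2.
have m0 : 0 < Num.min e (z - s) by rewrite lt_min e0 subr_gt0.
have m1 : Num.min e (z - s) <= e by rewrite ge_min lexx.
have m2 : Num.min e (z - s) <= z - s by rewrite ge_min lexx orbT.
have : v x < 0 by apply: he; rewrite /x; lra.
by rewrite ltNge ltW// vpos// /x; lra.
Qed.

Lemma solution_derive2 r : 0 < r -> (r%:E < Rr)%E ->
  is_derive r 1 v (f (phi r) + g (phi r) * v r `^ q - (c - 1) / r * v r).
Proof.
move=> r0 rR; have := solution_derive2_abs r0 rR.
by rewrite gtr0_norm// solution_derive_gt0.
Qed.

Lemma solution_ndecr s r : 0 < s -> s <= r -> (r%:E < Rr)%E -> phi s <= phi r.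
Proof.
move=> s0 sr rR; apply: (@derive_nonneg_le R phi v) => // x /andP[sx xr].
  by apply: solution_derive; [exact: lt_le_trans sx|exact: ereal_ltW rR].
rewrite ltW// solution_derive_gt0//; first exact: lt_trans sx.
by apply: ereal_ltW rR; exact: ltW.
Qed.

(** When [v] is small, friction and the source term each cost at most half of f(phi r1), so v' >= 0
    and [v] cannot sink further. It yields both a positive slope at a finite endpoint and unbounded
    growth of global solutions. *)
Lemma solution_derive_lower_bound r1 : 0 < r1 -> (r1%:E < Rr)%E ->
  exists2 d, 0 < d & forall r, r1 <= r -> (r%:E < Rr)%E -> d <= v r.
Proof.
move=> r10 r1R; pose m := f (phi r1); have m0 : 0 < m by exact: f_gt0.
pose G := `|g (phi r1)| + 1.
have G0 : 0 < G by rewrite /G; have := normr_ge0 (g (phi r1)); lra.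
pose C := (c - 1) / r1 + 1.
have C1 : 0 <= (c - 1) / r1 by rewrite divr_ge0 ?subr_ge0 ?(ltW r10).
have C0 : 0 < C by rewrite /C; lra.
have mG : 0 < m / 2 / G by rewrite divr_gt0// divr_gt0.
(* The three terms ensure v r1 >= d, friction at most m/2, and |g(phi r1)| v^q at most m/2 whenever
   v < d. *)
pose d := Num.min (v r1) (Num.min (m / 2 / C) ((m / 2 / G) `^ q^-1)).
have d0 : 0 < d.
  by rewrite !lt_min solution_derive_gt0//= powR_gt0// divr_gt0// divr_gt0.
have d1 : d <= v r1 by rewrite ge_min lexx.
have d2 : d <= m / 2 / C by rewrite !ge_min lexx !orbT.
have d3 : d <= (m / 2 / G) `^ q^-1 by rewrite !ge_min lexx !orbT.
exists d => // r r1r rR; rewrite leNgt; apply/negP => vr.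
have xR x : x <= r -> (x%:E < Rr)%E by move=> xr; exact: ereal_ltW rR.
have dD x : r1 <= x <= r -> is_derive x 1 (fun x => d - v x)
    (0 - (f (phi x) + g (phi x) * v x `^ q - (c - 1) / x * v x)).
  move=> /andP[r1x xr]; apply: (is_derive_sub (is_derive_const _ _)).
  by apply: solution_derive2; [exact: lt_le_trans r1x|exact: xR].
have [|||s [r1s sr Ds Dpos]] := @last_crossing R (fun x => d - v x) r1 r r1r.
- by move=> x xr; exact: is_derive_continuous (dD _ xr).
- by rewrite subr_le0.
- by rewrite subr_gt0.
have : d - v r <= d - v s.
  apply: (@derive_nonpos_ge R (fun x => d - v x) (fun x =>
    0 - (f (phi x) + g (phi x) * v x `^ q - (c - 1) / x * v x)) s r (ltW sr)).
    by move=> x /andP[sx xr]; apply: dD; rewrite xr andbT (le_trans r1s).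
  move=> x /andP[sx xr]; have x0 : 0 < x by lra.
  have vx0 : 0 < v x by apply: solution_derive_gt0 => //; apply: xR; exact: ltW.
  have vxd : v x < d by rewrite -subr_gt0 Dpos// sx ltW.
  have pp : phi r1 <= phi x.
    by apply: solution_ndecr => //; [lra|apply: xR; exact: ltW].
  have fm : m <= f (phi x) by exact: f_ndecr.
  have gG : - G <= g (phi x).
    apply: le_trans (g_ndecr pp); rewrite /G.
    by have := ler_norm (- g (phi r1)); rewrite normrN; lra.
  have vq : v x `^ q <= m / 2 / G.
    rewrite -[leRHS](powR_invK q_gt0 (ltW mG)).
    apply: ge0_ler_powR; rewrite ?nnegrE ?powR_ge0 ?(ltW q_gt0) ?(ltW vx0)//.
    exact: le_trans (ltW vxd) d3.
  have vq0 : 0 <= v x `^ q by exact: powR_ge0.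
  have s1 : v x `^ q * G <= m / 2 by rewrite -ler_pdivlMr.
  have s2 : (c - 1) / x * v x <= m / 2.
    apply: (@le_trans _ _ (C * v x)); last first.
      rewrite mulrC -ler_pdivlMr//; exact: le_trans (ltW vxd) d2.
    rewrite ler_wpM2r ?(ltW vx0)//; apply: (@le_trans _ _ ((c - 1) / r1)); last first.
      by rewrite /C lerDl.
    by rewrite ler_wpM2l ?subr_ge0// lef_pV2 ?posrE//; lra.
  have s3 : - (m / 2) <= g (phi x) * v x `^ q.
    apply: (@le_trans _ _ (- G * v x `^ q)); last by rewrite ler_wpM2r.
    by rewrite mulNr lerN2 mulrC.
  lra.
have : 0 < d - v r by rewrite subr_gt0.
by rewrite Ds; lra.
Qed.

End Solution.

(** * Gluing, and continuation past a finite endpoint *)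

Lemma ndecr_left_limit (h : R -> R) r1 R0 T : r1 < R0 ->
  (forall x y, r1 <= x -> x <= y -> y < R0 -> h x <= h y) ->
  (forall x, r1 <= x < R0 -> h x <= T) ->
  exists2 A, (forall x, r1 <= x < R0 -> h x <= A) &
    forall e, 0 < e -> exists2 d, 0 < d & forall x, R0 - d < x < R0 -> `|h x - A| < e.
Proof.
move=> r1R hmono hT.
pose V := [set h x | x in [set x | r1 <= x < R0]].
have supV : has_sup V.
  split; first by exists (h r1); exists r1 => //=; rewrite lexx.
  by exists T => _ [x xr <-]; exact: hT.
have ub x : r1 <= x < R0 -> h x <= sup V.
  by move=> xr; apply: sup_upper_bound => //; exists x.
exists (sup V) => // e e0.
have [_ [x /= /andP[r1x xR] <-] hx] := sup_adherent e0 supV.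
exists (R0 - x); first by rewrite subr_gt0.
move=> y /andP[xy yR]; have xy' : x <= y by lra.
have h1 := hmono _ _ r1x xy' yR.
have h2 : h y <= sup V by apply: ub; lra.
by rewrite ler0_norm ?subr_le0//; lra.
Qed.

Lemma piecewise_continuous (h1 h2 : R -> R) R0 :
  (forall e, 0 < e -> exists2 d, 0 < d & forall x, R0 - d < x < R0 ->
     `|h1 x - h2 R0| < e) ->
  {for R0, continuous h2} ->
  {for R0, continuous (fun x => if x < R0 then h1 x else h2 x)}.
Proof.
move=> left right; rewrite /prop_for /continuous_at ltxx; apply/cvgrPdist_lt => e e0.
have [d1 d10 hd1] := left _ e0.
have /cvgrPdist_lt/(_ _ e0)/nbhs_ballP[d2 /= d20 hd2] := right.
apply/nbhs_ballP; exists (Num.min d1 d2); first by rewrite /= lt_min d10.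
move=> x; rewrite /ball/= lt_min => /andP[x1 x2]; case: (ltP x R0) => xR; last exact: hd2.
by rewrite distrC hd1// xR andbT; move: x1; rewrite ltr_distlC => /andP[]; lra.
Qed.

Lemma is_derive_near_eq (h k : R -> R) r d e : 0 < e ->
  (forall x, `|x - r| < e -> k x = h x) -> is_derive r 1 h d -> is_derive r 1 k d.
Proof.
move=> e0 hk [dh eh].
have E : {near r, h =1 k}.
  apply/nbhs_ballP; exists e => //= x; rewrite /ball/= distrC => xe.
  by rewrite hk.
split; first exact: near_eq_derivable dh.
by rewrite -(near_eq_derive _ E).
Qed.

Lemma at_right_near_eq (h k : R -> R) (d l : R) : 0 < d ->
  (forall x, 0 < x < d -> k x = h x) -> h x @[x --> 0^'+] --> l ->
  k x @[x --> 0^'+] --> l.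
Proof.
move=> d0 hk; apply: cvg_trans; apply: near_eq_cvg.
exists d => //= x; rewrite /= sub0r normrN => xd x0; rewrite hk// x0.
by rewrite gtr0_norm in xd.
Qed.

(** All conditions at 0 are inherited from [phi]. Beyond them it suffices to provide a positive
    candidate derivative [w] satisfying the first-order system. *)
Lemma solution_extension (phi psi w : R -> R) R0 e : 0 < e ->
  is_solution q c f g a phi R0%:E ->
  (forall x, 0 <= x < R0 -> psi x = phi x) ->
  (forall x, 0 < x < R0 -> w x = derive1 phi x) ->
  (forall r, 0 < r < R0 + e -> [/\ 0 < w r, is_derive r 1 psi (w r) &
    is_derive r 1 w (rhs psi w r)]) ->
  is_solution q c f g a psi (R0 + e)%:E.
Proof.
move=> e0 sol psiE wE ode.
have R00 : 0 < R0 by have := solution_gt0 sol; rewrite lte_fin.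
have near_in r : 0 < r < R0 + e -> exists2 d, 0 < d &
    forall x, `|x - r| < d -> 0 < x < R0 + e.
  move=> /andP[r0 rR]; exists (Num.min r (R0 + e - r)).
    by rewrite lt_min r0 subr_gt0.
  by move=> x; rewrite lt_min => /andP[]; rewrite !ltr_distl; lra.
have d1 r : 0 < r < R0 + e -> derive1 psi r = w r.
  by move=> /ode[_ + _]; exact: is_derive_derive1.
have dd r : 0 < r < R0 + e -> is_derive r 1 (derive1 psi) (rhs psi w r).
  move=> rr; have [d d0 hd] := near_in _ rr; have [_ _] := ode _ rr.
  by apply: is_derive_near_eq d0 _ => x /hd; exact: d1.
have d2 r : 0 < r < R0 + e -> derive1n 2 psi r = rhs psi w r.
  by move=> /dd; exact: is_derive_derive1.
have phi2 r : 0 < r < R0 -> derive1n 2 phi r = rhs psi w r.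
  move=> rr; have /andP[r0 rR] := rr.
  have := solution_derive2 sol r0; rewrite lte_fin => /(_ rR) /is_derive_derive1.
  by rewrite /= => ->; rewrite /rhs wE// psiE// ltW.
(* Continuity of the second derivative is read off the equation; w > 0 makes the power
   continuous. *)
have crhs r : 0 < r < R0 + e -> {for r, continuous (rhs psi w)}.
  move=> rr; have [wr /is_derive_continuous cpsi /is_derive_continuous cw] := ode _ rr.
  have /andP[r0 _] := rr.
  apply: continuous_sub.
    apply: continuous_add; first by apply: continuous_compf => //; exact: f_cont.
    apply: continuous_mul; first by apply: continuous_compf => //; exact: g_cont.
    exact: continuous_powR_gt0.
  apply: continuous_mul => //; apply: continuous_mul; first exact: continuous_const.
  by apply: continuous_inv; [rewrite gt_eqF|exact: continuous_ident].
case: sol => _ [_ [cphi [_ [phi0 [v0 [h0 [L vL]]]]]]].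
split; first by rewrite lte_fin; lra.
split=> [r r0|].
  rewrite lte_fin => rR; have rr : 0 < r < R0 + e by rewrite r0.
  have [_ [dpsi _] _] := ode _ rr; have [ddpsi _] := dd _ rr.
  split; first exact: dpsi.
  split; first exact: ddpsi.
  have [d d0 hd] := near_in _ rr.
  rewrite /prop_for /continuous_at d2//.
  apply: cvg_trans (crhs _ rr); apply: near_eq_cvg.
  apply/nbhs_ballP; exists d => //= x; rewrite /ball/= distrC => /hd xx.
  by rewrite -d2.
split.
  rewrite psiE ?lexx//; apply: at_right_near_eq R00 _ cphi => x /andP[x0 xR].
  by rewrite psiE// xR ltW.
split=> [r r0|].
  rewrite lte_fin => rR; have rr : 0 < r < R0 + e by rewrite r0.
  by rewrite d2// d1// /rhs; have [wr _ _] := ode _ rr; rewrite gtr0_norm// subrK.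
split; first by rewrite psiE ?lexx.
split.
  apply: at_right_near_eq R00 _ v0 => x xR.
  by rewrite d1 ?wE//; lra.
split.
  apply: at_right_near_eq (R00) _ h0 => x /andP[x0 xR].
  have -> : psi x = phi x by apply: psiE; rewrite xR ltW.
  by have -> : psi 0 = phi 0 by apply: psiE; rewrite lexx R00.
exists L; apply: at_right_near_eq R00 _ vL => x xR.
by rewrite d2 ?phi2//; lra.
Qed.

Lemma powR_le_1_sqr x : 0 < x -> x `^ q <= 1 + x ^+ 2.
Proof.
move=> x0; have x2 : 0 <= x ^+ 2 by exact: sqr_ge0.
have [x1|/ltW x1] := leP x 1.
  apply: (@le_trans _ _ 1); last lra.
  by rewrite -[leRHS](powRr0 x); apply: ger_powR; rewrite ?x0 ?(ltW q_gt0).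
apply: (@le_trans _ _ (x ^+ 2)); last lra.
by rewrite -powR_mulrn ?(ltW x0)//; apply: ler_powR.
Qed.

(** Bounded phi gives bounded [v], then v' bounded below, so v + K2 r is monotone and [v] has a
    limit at [R0]. The local problem is restarted from the limits of phi and [v], and the two pieces
    are glued. *)
Lemma bounded_solution_extends phi R0 T : is_solution q c f g a phi R0%:E ->
  (forall r, 0 < r < R0 -> phi r <= T) ->
  exists psi Rr', [/\ (R0%:E < Rr')%E, is_solution q c f g a psi Rr' &
    forall r, 0 <= r -> (r%:E < R0%:E)%E -> psi r = phi r].
Proof.
move=> sol phiT; pose v := derive1 phi.
have R00 : 0 < R0 by have := solution_gt0 sol; rewrite lte_fin.
pose r1 := R0 / 2; have r10 : 0 < r1 by rewrite /r1; lra.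
have r1R : r1 < R0 by rewrite /r1; lra.
have dphi r : 0 < r < R0 -> is_derive r 1 phi (v r).
  by move=> /andP[r0 rR]; apply: (solution_derive sol).
have dv r : 0 < r < R0 -> is_derive r 1 v (rhs phi v r).
  by move=> /andP[r0 rR]; apply: (solution_derive2 sol).
have v0 r : 0 < r < R0 -> 0 < v r.
  by move=> /andP[r0 rR]; apply: (solution_derive_gt0 sol).
have phi_mono s r : 0 < s -> s <= r -> r < R0 -> phi s <= phi r.
  by move=> s0 sr rR; apply: (solution_ndecr sol).
(* Since v^q <= 1 + v^2 (here q <= 2 enters), (1 + v^2)' <= K v (1 + v^2) with K = 2 (f T + G).
   Hence (1 + v^2) exp(-K phi) is nonincreasing, which gives v <= W. *)
have F0 := f_gt0 T; pose G := `|g T|; pose K := 2 * (f T + G).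
have G0 : 0 <= G by exact: normr_ge0.
pose W := (1 + v r1 ^+ 2) * expR (K * (T - phi r1)).
have vW r : r1 <= r < R0 -> v r <= W.
  move=> /andP[r1r rR].
  have inR x : r1 <= x <= r -> 0 < x < R0 by lra.
  pose y x := (1 + v x ^+ 2) * expR (- K * phi x).
  have : y r <= y r1.
    apply: (@derive_nonpos_ge R y (fun x => (1 + v x ^+ 2) *
      (expR (- K * phi x) * (- K * v x)) + expR (- K * phi x) *
      (0 + 2 * v x * rhs phi v x)) r1 r r1r).
      move=> x xr; apply: is_derive_mul.
        apply: (is_derive_add (is_derive_const _ _)).
        by apply: is_derive_sqr; apply: dv; exact: inR.
      apply: is_derive_chain; apply: is_derive_scale; apply: dphi; exact: inR.
    move=> x /andP[/ltW r1x /ltW xr]; have xR : 0 < x < R0 by apply: inR; rewrite r1x.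
    rewrite (_ : _ + _ = expR (- K * phi x) * (v x *
      (2 * rhs phi v x - K * (1 + v x ^+ 2)))); last by ring.
    rewrite mulr_ge0_le0 ?expR_ge0// mulr_ge0_le0 ?(ltW (v0 _ xR))//.
    have fT : f (phi x) <= f T by apply: f_ndecr; exact: phiT.
    have vq0 : 0 <= v x `^ q by exact: powR_ge0.
    have gT : g (phi x) * v x `^ q <= G * (1 + v x ^+ 2).
      apply: (@le_trans _ _ (G * v x `^ q)).
        rewrite ler_wpM2r//; apply: le_trans (ler_norm _).
        by apply: g_ndecr; exact: phiT.
      by rewrite ler_wpM2l// powR_le_1_sqr// v0.
    have fr : 0 <= (c - 1) / x * v x.
      by rewrite mulr_ge0 ?(ltW (v0 _ xR))// divr_ge0 ?subr_ge0//; lra.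
    have v2 : 0 <= v x ^+ 2 by exact: sqr_ge0.
    have : f T <= f T * (1 + v x ^+ 2) by rewrite ler_peMr ?(ltW F0)//; lra.
    rewrite /rhs /K; lra.
  move=> yy; have rR' : 0 < r < R0 by lra.
  have step : 1 + v r ^+ 2 <= W.
    have e0 : 0 < expR (- K * phi r) by exact: expR_gt0.
    rewrite -(ler_pM2r e0); apply: le_trans yy _.
    have v2 : 0 <= 1 + v r1 ^+ 2 by have := sqr_ge0 (v r1); lra.
    rewrite /y /W -mulrA ler_wpM2l//.
    rewrite -expRD ler_expR.
    have : phi r <= T by exact: phiT.
    have K0 : 0 <= K by rewrite /K; lra.
    by move=> /(ler_wpM2l K0); rewrite mulrBr; lra.
  have := sqr_ge0 (v r - 1); have vr := v0 _ rR'; nra.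
(* Now v <= W bounds both negative contributions to v', and their sum is at most [K2]. *)
pose G2 := `|g (phi r1)|.
pose K2 := G2 * W `^ q + (c - 1) / r1 * W.
have vlip r : r1 <= r < R0 -> - K2 <= rhs phi v r.
  move=> rr; have /andP[r1r rR] := rr; have rR' : 0 < r < R0 by lra.
  have vr := v0 _ rR'; have vrW := vW _ rr.
  have fr : (c - 1) / r * v r <= (c - 1) / r1 * W.
    apply: ler_pM => //; [by rewrite divr_ge0 ?subr_ge0//; lra|exact: ltW|].
    by rewrite ler_wpM2l ?subr_ge0// lef_pV2 ?posrE//; lra.
  have gr : - (G2 * W `^ q) <= g (phi r) * v r `^ q.
    apply: (@le_trans _ _ (- G2 * v r `^ q)).
      rewrite mulNr lerN2 ler_wpM2l ?normr_ge0//.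
      by apply: ge0_ler_powR; rewrite ?nnegrE ?(ltW q_gt0)//; lra.
    rewrite ler_wpM2r ?powR_ge0//.
    have gm : g (phi r1) <= g (phi r) by apply: g_ndecr; exact: phi_mono.
    by rewrite /G2; have := ler_norm (- g (phi r1)); rewrite normrN; lra.
  by have := f_gt0 (phi r); rewrite /rhs /K2; lra.
have [||A _ phiA] := @ndecr_left_limit phi r1 R0 T r1R.
- by move=> x y r1x xy yR; apply: phi_mono => //; lra.
- by move=> x xr; apply: phiT; lra.
have [||B0 B0ub vB0] := @ndecr_left_limit (fun x => v x + K2 * x) r1 R0 (W + `|K2| * R0) r1R.
- move=> x y r1x xy yR.
  apply: (@derive_nonneg_le R (fun x => v x + K2 * x)
    (fun z => rhs phi v z + K2 * 1) x y xy).
    move=> z zz; apply: is_derive_add; first by apply: dv; lra.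
  move=> z zz; have : - K2 <= rhs phi v z by apply: vlip; lra.
  lra.
- move=> x xr; apply: lerD; first exact: vW.
  apply: le_trans (ler_norm _) _; rewrite normrM ler_wpM2l ?normr_ge0//.
  by rewrite ger0_norm; lra.
pose B := B0 - K2 * R0.
have vB e : 0 < e -> exists2 d, 0 < d & forall x, R0 - d < x < R0 -> `|v x - B| < e.
  move=> e0; have e2 : 0 < e / 2 by lra.
  have [d1 d10 hd1] := vB0 _ e2.
  have K20 : 0 < `|K2| + 1 by have := normr_ge0 K2; lra.
  exists (Num.min d1 (e / 2 / (`|K2| + 1))).
    by rewrite lt_min d10 divr_gt0.
  move=> x /andP[xl xR].
  have m1 : Num.min d1 (e / 2 / (`|K2| + 1)) <= d1 by rewrite ge_min lexx.
  have m2 : Num.min d1 (e / 2 / (`|K2| + 1)) <= e / 2 / (`|K2| + 1).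
    by rewrite ge_min lexx orbT.
  have hx : `|v x + K2 * x - B0| < e / 2 by apply: hd1; lra.
  have kx : `|K2 * (R0 - x)| < e / 2.
    have Rx : R0 - x < e / 2 / (`|K2| + 1) by lra.
    rewrite normrM (ger0_norm (_ : 0 <= R0 - x)); last lra.
    rewrite ltr_pdivlMr// in Rx; apply: le_lt_trans Rx.
    by rewrite mulrC ler_wpM2l; lra.
  rewrite (_ : v x - B = (v x + K2 * x - B0) + K2 * (R0 - x)); last by rewrite /B; ring.
  by apply: le_lt_trans (ler_normD _ _) _; lra.
(* The uniform lower bound on [v] passes to the limit [B], whose positivity local existence
   requires. *)
have [|d d0 vd] := @solution_derive_lower_bound _ _ sol r1 r10; first by rewrite lte_fin.
have B_gt0 : 0 < B.
  rewrite ltNge; apply/negP => B_le0.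
  have [d1 d10 hd1] := vB _ d0.
  pose x := R0 - Num.min d1 (R0 - r1) / 2.
  have m0 : 0 < Num.min d1 (R0 - r1) by rewrite lt_min d10 subr_gt0.
  have m1 : Num.min d1 (R0 - r1) <= d1 by rewrite ge_min lexx.
  have m2 : Num.min d1 (R0 - r1) <= R0 - r1 by rewrite ge_min lexx orbT.
  have : `|v x - B| < d by apply: hd1; rewrite /x; lra.
  have : d <= v x by apply: vd; rewrite ?lte_fin /x; lra.
  by move=> ?; rewrite ltr_norml; lra.
have [p [w [e [e0 pA wB pw]]]] :=
  @local_solution R q c f g R0 A B q_gt0 c_ge1 f_cont f_ndecr f_gt0 g_cont g_ndecr R00 B_gt0.
pose psi x := if x < R0 then phi x else p x.
pose z x := if x < R0 then v x else w x.
exists psi, (R0 + e)%:E; split; first by rewrite lte_fin; lra.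
  2: by move=> r _; rewrite lte_fin /psi => ->.
have psiL x : x < R0 -> psi x = phi x by rewrite /psi => ->.
have psiR x : R0 <= x -> psi x = p x by rewrite /psi ltNge => ->.
have zL x : x < R0 -> z x = v x by rewrite /z => ->.
have zR x : R0 <= x -> z x = w x by rewrite /z ltNge => ->.
have R0R0 : R0 <= R0 < R0 + e by lra.
have cpsi : {for R0, continuous psi}.
  apply: piecewise_continuous; first by rewrite pA; exact: phiA.
  by have [_ + _] := pw _ R0R0; exact: is_derive_continuous.
have cz : {for R0, continuous z}.
  apply: piecewise_continuous; first by rewrite wB; exact: vB.
  by have [_ _ +] := pw _ R0R0; exact: is_derive_continuous.
have z_gt0 x : 0 < x < R0 + e -> 0 < z x.
  move=> xx; have [xR|xR] := ltP x R0.
    by rewrite zL// v0//; lra.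
  by rewrite zR//; have [|] := pw x; lra.
have dpsi x : 0 < x < R0 + e -> x != R0 -> is_derive x 1 psi (z x).
  move=> /andP[x0 xe] xR; have [xlt|xgt|xeq] := ltgtP x R0; last by rewrite xeq eqxx in xR.
    rewrite zL//; have := dphi x; rewrite x0 xlt => /(_ isT).
    apply: (@is_derive_near_eq _ _ _ _ (R0 - x)); first by rewrite subr_gt0.
    by move=> y; rewrite ltr_distl => ?; apply: psiL; lra.
  rewrite zR ?(ltW xgt)//; have [|_ + _] := pw x; first by rewrite xe ltW.
  apply: (@is_derive_near_eq _ _ _ _ (x - R0)); first by rewrite subr_gt0.
  by move=> y; rewrite ltr_distl => ?; apply: psiR; lra.
have dz x : 0 < x < R0 + e -> x != R0 -> is_derive x 1 z (rhs psi z x).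
  move=> /andP[x0 xe] xR; have [xlt|xgt|xeq] := ltgtP x R0; last by rewrite xeq eqxx in xR.
    rewrite /rhs zL// psiL//; have := dv x; rewrite x0 xlt => /(_ isT).
    apply: (@is_derive_near_eq _ _ _ _ (R0 - x)); first by rewrite subr_gt0.
    by move=> y; rewrite ltr_distl => ?; apply: zL; lra.
  rewrite /rhs zR ?psiR ?(ltW xgt)//; have [|_ _] := pw x; first by rewrite xe ltW.
  apply: (@is_derive_near_eq _ _ _ _ (x - R0)); first by rewrite subr_gt0.
  by move=> y; rewrite ltr_distl => ?; apply: zR; lra.
have R0e : 0 < R0 < R0 + e by lra.
apply: (@solution_extension phi psi z) => //.
- by move=> x /andP[_]; exact: psiL.
- by move=> x /andP[_]; exact: zL.
- move=> r rr; split; first exact: z_gt0.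
    have [->|rR] := eqVneq r R0; last exact: dpsi.
    exact: (is_derive_continuous_extension R0e dpsi).
  have [->|rR] := eqVneq r R0; last exact: dz.
  apply: (is_derive_continuous_extension R0e dz) => //.
  apply: continuous_sub.
    apply: continuous_add; first by apply: continuous_compf => //; exact: f_cont.
    apply: continuous_mul; first by apply: continuous_compf => //; exact: g_cont.
    by apply: continuous_powR_gt0 => //; exact: z_gt0.
  apply: continuous_mul => //; apply: continuous_mul; first exact: continuous_const.
  by apply: continuous_inv; [rewrite gt_eqF|exact: continuous_ident].
Qed.

(** With a finite endpoint, a bounded phi would extend, against maximality. With an infinite one,
    the positive lower bound on phi' forces linear growth. *)
Lemma maximal_solution_unbounded phi Rr T :
  is_maximal_solution q c f g a phi Rr ->
  exists r, [/\ 0 < r, (r%:E < Rr)%E & T < phi r].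
Proof.
move=> [sol maxi]; apply: contrapT => nexist.
have phiT r : 0 < r -> (r%:E < Rr)%E -> phi r <= T.
  by move=> r0 rR; rewrite leNgt; apply/negP => Tr; apply: nexist; exists r.
have R0 := solution_gt0 sol.
case: Rr => [s| |] in sol maxi nexist phiT R0 *; last by [].
  have [|psi [Rr' [lt_R sol' ext]]] := @bounded_solution_extends phi s T sol.
    by move=> r /andP[r0 rs]; apply: phiT; rewrite ?lte_fin.
  by apply: maxi; exists psi, Rr'.
have [|d d0 vd] := @solution_derive_lower_bound _ _ sol 1 ltr01; first by rewrite ltry.
pose r := 1 + (`|T - phi 1| + 1) / d.
have r1 : 1 <= r by rewrite /r lerDl divr_ge0 ?(ltW d0)// addr_ge0.
have : d * r - d * 1 <= phi r - phi 1.
  apply: (@derive_le_increment R (fun x => d * x) (fun=> d * 1) phi (derive1 phi) 1 r r1).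
  - by move=> x /andP[x1 _]; apply: (solution_derive sol); rewrite ?ltry//; lra.
  - by move=> x /andP[x1 _]; rewrite mulr1; apply: vd; rewrite ?ltry// ltW.
have -> : d * r - d * 1 = `|T - phi 1| + 1 by rewrite /r; field; rewrite gt_eqF.
have : phi r <= T by apply: phiT; rewrite ?ltry//; lra.
have := ler_norm (T - phi 1); lra.
Qed.

End Solutions.

(** * Divergence criteria and the envelope E *)

Section Comparison.
Context {R : realType}.
Implicit Types (x y s t : R) (h k : R -> R).

(** The sign of [dD] is checked only where D > 0, so the negation of the bound being proved becomes
    an extra hypothesis. *)
Lemma barrier_le (D dD : R -> R) x y : x <= y ->
  (forall z, x <= z <= y -> is_derive z 1 D (dD z)) -> D x <= 0 ->
  (forall z, x < z < y -> 0 < D z -> dD z <= 0) -> D y <= 0.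
Proof.
move=> xy dDP Dx Dpos; rewrite leNgt; apply/negP => Dy.
have [||//|s [xs sy Ds Dgt]] := @last_crossing R D x y xy.
- by move=> z zxy; exact: is_derive_continuous (dDP _ zxy).
- by [].
have : D y <= D s.
  apply: (@derive_nonpos_ge R D dD s y (ltW sy)).
    by move=> z /andP[sz zy]; apply: dDP; rewrite zy (le_trans xs).
  move=> z /andP[sz zy]; apply: Dpos; first by rewrite zy (le_lt_trans xs).
  by apply: Dgt; rewrite sz ltW.
by rewrite Ds leNgt Dy.
Qed.

(** Change of variable at the level of primitives. The dilation [lam] allows comparisons between t
    and 2t with no doubling assumption. *)
Lemma diverges_scaled_le h k (lam C : R) : 0 < lam -> 0 < C ->
  (forall t, 0 < t -> {for t, continuous h}) -> (forall t, 0 < t -> 0 <= h t) ->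
  (forall t, 0 < t -> {for t, continuous k}) -> (forall t, 0 < t -> 0 <= k t) ->
  (forall t, 0 < t -> h (lam * t) <= C * k t) ->
  integral_diverges h -> integral_diverges k.
Proof.
move=> lam0 C0 ch h0 ck k0 hk.
have [P dP] := pos_has_primitive ch; have [Q dQ] := pos_has_primitive ck.
move=> /(integral_diverges_primitive ch h0 dP) unb.
apply/(integral_diverges_primitive ck k0 dQ) => B.
have [x [y [x0 xy BP]]] := unb (lam * C * B).
have x'0 : 0 < x / lam by rewrite divr_gt0.
have xy' : x / lam <= y / lam by rewrite ler_wpM2r// invr_ge0 ltW.
exists (x / lam), (y / lam); split => //.
have lC : 0 < lam * C by rewrite mulr_gt0.
rewrite -(ltr_pM2l lC) mulrBr; apply: lt_le_trans BP _.
have := @derive_le_increment R (fun t => P (lam * t)) (fun t => h (lam * t) * (lam * 1))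
  (fun t => lam * C * Q t) (fun t => lam * C * k t) _ _ xy'.
rewrite !(mulrC lam (_ / lam)) !divfK ?gt_eqF//; apply.
- move=> t /andP[xt _]; have t0 := lt_le_trans x'0 xt.
  by apply: is_derive_chain; apply: dP; rewrite mulr_gt0.
- move=> t /andP[xt _]; apply: is_derive_scale; apply: dQ; exact: lt_le_trans xt.
- move=> t /andP[xt _]; rewrite mulr1 mulrC -mulrA ler_pM2l//.
  by apply: hk; exact: lt_trans xt.
Qed.

Lemma continuous_sqrt_gt0 h t : {for t, continuous h} -> 0 < h t ->
  {for t, continuous (fun y => Num.sqrt (h y))}.
Proof.
move=> ch h0; apply: (@continuous_compf R Num.sqrt) => //.
exact: is_derive_continuous (is_derive1_sqrt h0).
Qed.

Lemma continuous_inv_sqrt h t : {for t, continuous h} -> 0 < h t ->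
  {for t, continuous (fun y => (Num.sqrt (h y))^-1)}.
Proof.
move=> ch h0; apply: continuous_inv; first by rewrite gt_eqF// sqrtr_gt0.
exact: continuous_sqrt_gt0.
Qed.

(* If v = p' is bounded by a multiple of 1 / h(p), then P(p) grows at most
   linearly, P being a primitive of h. *)
Lemma bounded_interval_not_diverges h (p v : R -> R) (r1 Rb C : R) :
  (forall t, 0 < t -> {for t, continuous h}) -> (forall t, 0 < t -> 0 <= h t) ->
  (forall T, 0 < T -> exists K, forall t, 0 < t <= T -> h t <= K / Num.sqrt t) ->
  0 < p r1 ->
  (forall r, r1 <= r < Rb -> is_derive r 1 p (v r)) ->
  (forall r, r1 <= r < Rb -> 0 < v r) ->
  (forall T, exists2 r, r1 <= r < Rb & T < p r) ->
  (forall r, r1 <= r < Rb -> h (p r) * v r <= C) ->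
  ~ integral_diverges h.
Proof.
move=> ch h0 h_near0 p0 dp v0 punb hv; have [P dP] := pos_has_primitive ch.
move=> /(integral_diverges_primitive ch h0 dP) unb.
have Pmono x y : 0 < x -> x <= y -> P x <= P y.
  move=> x0 xy; apply: (@derive_nonneg_le R P h x y xy) => z /andP[xz _].
    by apply: dP; exact: lt_le_trans xz.
  by apply: h0; exact: lt_trans xz.
have [K hK] := h_near0 _ p0.
pose K' := `|K|.
(* The bound K / sqrt t is integrable at 0, so the divergence cannot come from the origin. *)
have low x : 0 < x -> x <= p r1 -> P (p r1) - P x <= 2 * K' * Num.sqrt (p r1).
  move=> x0 xp.
  have : P (p r1) - P x <= 2 * K' * Num.sqrt (p r1) - 2 * K' * Num.sqrt x.
    apply: (@derive_le_increment R P h (fun t => 2 * K' * Num.sqrt t)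
      (fun t => 2 * K' * (2 * Num.sqrt t)^-1)) => //.
    - by move=> t /andP[xt _]; apply: dP; exact: lt_le_trans xt.
    - move=> t /andP[xt _]; apply: is_derive_scale.
      by apply: is_derive1_sqrt; exact: lt_le_trans xt.
    - move=> t /andP[xt tp]; have t0 := lt_trans x0 xt.
      apply: (le_trans (hK _ _)); first by rewrite t0 ltW.
      have s0 : 0 < Num.sqrt t by rewrite sqrtr_gt0.
      rewrite (_ : 2 * K' * (2 * Num.sqrt t)^-1 = K' / Num.sqrt t); last first.
        by field; rewrite gt_eqF.
      by rewrite ler_wpM2r ?invr_ge0 ?(ltW s0)// ler_norm.
  have : 0 <= 2 * K' * Num.sqrt x by rewrite !mulr_ge0 ?sqrtr_ge0 ?normr_ge0.
  lra.
pose C' := `|C|.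
(* The level y is exceeded before time [Rb], and up to then P(p) grows at rate at most [C']. *)
have high y : P y - P (p r1) <= C' * (Rb - r1) \/ y <= p r1.
  have [|py] := leP y (p r1); first by right.
  left; have [r /andP[r1r rR] yr] := punb y.
  have pr : P (p r) - P (p r1) <= C' * r - C' * r1.
    apply: (@derive_le_increment R (fun s => P (p s)) (fun s => h (p s) * v s)
      (fun s => C' * s) (fun=> C' * 1)) => //.
    - move=> s /andP[r1s sr]; have sR : r1 <= s < Rb by rewrite r1s (le_lt_trans sr).
      apply: is_derive_chain; last exact: dp.
      apply: dP; apply: lt_le_trans p0 _.
      apply: (@derive_nonneg_le R p v r1 s r1s).
        by move=> z /andP[r1z zs]; apply: dp; rewrite r1z; lra.
      by move=> z /andP[r1z zs]; apply/ltW/v0; lra.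
    - by move=> s /andP[r1s sr]; rewrite mulr1; apply: (le_trans (hv _ _));
        [lra|exact: ler_norm].
  have : P y <= P (p r) by apply: Pmono; [exact: lt_trans py|exact: ltW].
  have : C' * r <= C' * Rb by rewrite ler_wpM2l ?normr_ge0// ltW.
  lra.
have [x [y [x0 xy]]] := unb (2 * K' * Num.sqrt (p r1) + `|C' * (Rb - r1)|).
have A0 : 0 <= 2 * K' * Num.sqrt (p r1) by rewrite !mulr_ge0 ?sqrtr_ge0 ?normr_ge0.
have A1 := normr_ge0 (C' * (Rb - r1)); have A2 := ler_norm (C' * (Rb - r1)).
apply/negP; rewrite -leNgt.
have Hy : P y - P (p r1) <= `|C' * (Rb - r1)|.
  have [|yp] := high y; first lra.
  by have := Pmono y (p r1) (lt_le_trans x0 xy) yp; lra.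
have Hx : P (p r1) - P x <= 2 * K' * Num.sqrt (p r1).
  have [xp|/ltW px] := leP x (p r1); first exact: low.
  by have := Pmono (p r1) x p0 px; lra.
lra.
Qed.

(** P(lam p(r)) has derivative at least lam k, so it grows without bound as r runs over an infinite
    interval. *)
Lemma global_growth_diverges h (p v : R -> R) (r1 lam k : R) :
  (forall t, 0 < t -> {for t, continuous h}) -> (forall t, 0 < t -> 0 <= h t) ->
  0 < lam -> 0 < k -> 0 < p r1 ->
  (forall r, r1 <= r -> is_derive r 1 p (v r)) ->
  (forall r, r1 <= r -> 0 < v r) ->
  (forall r, r1 <= r -> k <= h (lam * p r) * v r) ->
  integral_diverges h.
Proof.
move=> ch h0 lam0 k0 p0 dp v0 hv; have [P dP] := pos_has_primitive ch.
apply/(integral_diverges_primitive ch h0 dP) => B.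
have kl : 0 < lam * k by rewrite mulr_gt0.
pose r := r1 + (`|B| + 1) / (lam * k).
have r1r : r1 <= r by rewrite /r lerDl divr_ge0 ?(ltW kl)// addr_ge0.
have pmono s t : r1 <= s -> s <= t -> p s <= p t.
  move=> r1s st; apply: (@derive_nonneg_le R p v s t st) => z /andP[sz _].
    by apply: dp; exact: le_trans sz.
  by apply/ltW/v0; exact: (le_trans r1s (ltW sz)).
exists (lam * p r1), (lam * p r); split.
- exact: mulr_gt0.
- by rewrite ler_pM2l// pmono.
have : lam * k * r - lam * k * r1 <= P (lam * p r) - P (lam * p r1).
  apply: (@derive_le_increment R (fun s => lam * k * s) (fun=> lam * k * 1)
    (fun s => P (lam * p s)) (fun s => h (lam * p s) * (lam * v s))) => //.
  - move=> s /andP[r1s _]; apply: is_derive_chain.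
      by apply: dP; rewrite mulr_gt0// (lt_le_trans p0)// pmono.
    by apply: is_derive_scale; exact: dp.
  - by move=> s /andP[r1s _]; rewrite mulr1 mulrCA ler_pM2l// hv// ltW.
have -> : lam * k * r - lam * k * r1 = `|B| + 1 by rewrite /r; field; rewrite !gt_eqF.
by have := ler_norm B; lra.
Qed.

End Comparison.

(** * The linear equation whose solution is the squared denominator in (ii) *)

Section Envelope.
Context {R : realType} (q : R) (f g : R -> R).
Context (q_gt0 : 0 < q) (q_le2 : q <= 2).
Context (f_cont : continuous f) (f_ndecr : {homo f : x y / x <= y}).
Context (f_gt0 : forall t, 0 < f t).
Context (g_cont : continuous g) (g_ndecr : {homo g : x y / x <= y}).
Implicit Types (s t T : R).

Definition damping t : R := (negp g t / f t) `^ (2 / q) * f t.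

Lemma negp_ge0 t : 0 <= negp g t.
Proof. by rewrite /negp le_max lexx orbT. Qed.

Lemma negp_nincr s t : s <= t -> negp g t <= negp g s.
Proof.
move=> st; rewrite /negp ge_max !le_max lexx orbT andbT.
by rewrite lerN2 g_ndecr.
Qed.

Lemma damping_ge0 t : 0 <= damping t.
Proof. by rewrite /damping mulr_ge0 ?powR_ge0// ltW. Qed.

Lemma damping_ratio_nincr s t : s <= t -> damping t / f t <= damping s / f s.
Proof.
move=> st; rewrite /damping !mulfK ?gt_eqF//.
have p0 : 0 <= 2 / q by rewrite divr_ge0// ltW.
apply: ge0_ler_powR => //; rewrite ?nnegrE ?divr_ge0 ?negp_ge0 ?(ltW (f_gt0 _))//.
apply: ler_pM; rewrite ?negp_ge0 ?invr_ge0 ?(ltW (f_gt0 _)) ?negp_nincr//.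
by rewrite lef_pV2 ?posrE// f_ndecr.
Qed.

(** Formally the damping is (g^-)^(2/q) f^(1 - 2/q), and q <= 2 makes the exponent of [f]
    nonpositive; the proof uses x^(2/q) <= x for x = f s / f t in (0, 1]. *)
Lemma damping_nincr s t : s <= t -> damping t <= damping s.
Proof.
move=> st; have fs := f_gt0 s; have ft := f_gt0 t.
have fst : f s <= f t by exact: f_ndecr.
have p1 : 1 <= 2 / q by rewrite ler_pdivlMr// mul1r.
have G0 s' : 0 <= negp g s' / f s' by rewrite divr_ge0 ?negp_ge0// ltW.
have ratio : 0 < f s / f t <= 1 by rewrite divr_gt0//= ler_pdivrMr// mul1r.
have step : negp g t / f t <= negp g s / f s * (f s / f t).
  rewrite (_ : _ * (f s / f t) = negp g s / f t); last by field; rewrite !gt_eqF.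
  by rewrite ler_wpM2r ?invr_ge0 ?(ltW ft)// negp_nincr.
rewrite /damping; apply: (@le_trans _ _ ((negp g s / f s * (f s / f t)) `^ (2 / q) * f t)).
  rewrite ler_wpM2r ?(ltW ft)//; apply: ge0_ler_powR; rewrite ?nnegrE ?G0//; first lra.
  by rewrite mulr_ge0 ?G0//; case/andP: ratio => /ltW.
rewrite powRM ?G0//; last by case/andP: ratio => /ltW.
rewrite -mulrA ler_wpM2l ?powR_ge0//.
apply: (@le_trans _ _ (f s / f t * f t)); last by rewrite divfK ?gt_eqF.
by rewrite ler_wpM2r ?(ltW ft)//; exact: ge1r_powR.
Qed.

Lemma damping_continuous : continuous damping.
Proof.
move=> t; suff : {for t, continuous damping} by [].
apply: continuous_mul; last exact: f_cont.
apply: (@continuous_powR_ge0 _ _ _ _ 1); rewrite ?ltr01 ?divr_gt0//.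
  apply: continuous_mul; last by apply: continuous_inv; [rewrite gt_eqF|exact: f_cont].
  apply: continuous_maxf; last exact: continuous_const.
  by apply: continuousN; exact: g_cont.
by move=> y _; rewrite divr_ge0 ?negp_ge0// ltW.
Qed.

(** Variation of constants: with [N] a primitive of the damping, E(t) is exp(-2 N t) times the
    integral of exp(2 N) f from 0. The fourth clause says that E' >= 0; the last makes 1 / sqrt E
    integrable at 0. *)
Lemma integrand_ii_envelope : exists E : R -> R,
  [/\ forall t, 0 <= t -> integrand_ii q f g t = (Num.sqrt (E t))^-1,
      E 0 = 0,
      forall t, is_derive t 1 E (f t - 2 * damping t * E t),
      forall t, 0 <= t -> 2 * damping t * E t <= f t &
      forall T, 0 < T -> exists2 k, 0 < k & forall t, 0 <= t <= T -> k * t <= E t].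
Proof.
have [N dN] := continuous_has_primitive damping_continuous.
have cN t : {for t, continuous N} by exact: is_derive_continuous (dN t).
have cexpN t : {for t, continuous (fun s => expR (2 * N s) * f s)}.
  apply: continuous_mul; last exact: f_cont.
  apply: (@continuous_compf R expR); last exact: continuous_expR.
  by apply: continuous_mul; [exact: continuous_const|exact: cN].
have [Q dQ] := continuous_has_primitive cexpN.
have dexp k t : is_derive t 1 (fun s => expR (k * N s)) (expR (k * N t) * (k * damping t)).
  by apply: is_derive_chain; apply: is_derive_scale; exact: dN.
have Nmono s t : s <= t -> N s <= N t.
  move=> st; apply: (derive_nonneg_le st (fun z _ => dN z)) => z _; exact: damping_ge0.
pose E t := expR (- 2 * N t) * (Q t - Q 0).
exists E; split.
- move=> t t0; rewrite /integrand_ii; congr ((Num.sqrt _)^-1).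
  have -> : Defs.Rint (fun s => expR (- 2 * Defs.Rint (fun tau =>
        (negp g tau / f tau) `^ (2 / q) * f tau) s t) * f s) 0 t =
      Defs.Rint (fun s => expR (- 2 * N t) * (expR (2 * N s) * f s)) 0 t.
    rewrite /Defs.Rint; congr fine; apply: eq_integral => s.
    rewrite inE/= in_itv/= => /andP[s0 st]; congr EFin.
    rewrite -[fine _]/(Defs.Rint damping s t) (@Rint_primitive R damping N)//; last first.
      exact: damping_continuous.
    by rewrite mulrA -expRD; congr (expR _ * _); ring.
  rewrite (@Rint_primitive R _ (fun s => expR (- 2 * N t) * Q s))//.
  + by rewrite /E mulrBr.
  + move=> s.
    suff : {for s, continuous (fun s => expR (- 2 * N t) * (expR (2 * N s) * f s))} by [].
    by apply: continuous_mul; [exact: continuous_const|exact: cexpN].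
- by rewrite /E subrr mulr0.
- move=> t; have := is_derive_mul (dexp (- 2) t) (is_derive_sub (dQ t) (is_derive_const (Q 0) t)).
  congr is_derive; rewrite subr0 mulrA -expRD.
  by rewrite (_ : - 2 * N t + 2 * N t = 0) ?expR0 /E; ring.
- move=> t t0; have ft := f_gt0 t.
  (* As damping / f is nonincreasing, its value at t may be replaced under the integral by its value
     at s <= t, which leaves exp(2 N) times the damping, the exact derivative of exp(2 N) / 2. *)
  have : damping t / f t * Q t - damping t / f t * Q 0 <=
      2^-1 * expR (2 * N t) - 2^-1 * expR (2 * N 0).
    apply: (@derive_le_increment R (fun s => damping t / f t * Q s)
      (fun s => damping t / f t * (expR (2 * N s) * f s))
      (fun s => 2^-1 * expR (2 * N s))
      (fun s => 2^-1 * (expR (2 * N s) * (2 * damping s)))) => //.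
    move=> s /andP[_ /ltW st].
    have -> : 2^-1 * (expR (2 * N s) * (2 * damping s)) = expR (2 * N s) * damping s by field.
    rewrite mulrCA ler_wpM2l ?expR_ge0// -ler_pdivlMr//.
    exact: damping_ratio_nincr.
  have e0 := expR_gt0 (2 * N 0).
  have et : expR (- 2 * N t) * expR (2 * N t) = 1.
    by rewrite -expRD (_ : - 2 * N t + 2 * N t = 0) ?expR0//; ring.
  move=> H; rewrite -[leRHS]mul1r -ler_pdivrMr//.
  have -> : 2 * damping t * E t / f t =
      expR (- 2 * N t) * (2 * (damping t / f t * Q t - damping t / f t * Q 0)).
    by rewrite /E; field; rewrite gt_eqF.
  rewrite -[leRHS]et ler_wpM2l ?expR_ge0//; lra.
- move=> T T0; exists (expR (- 2 * N T) * (expR (2 * N 0) * f 0)).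
    by rewrite !mulr_gt0 ?expR_gt0.
  move=> t /andP[t0 tT]; rewrite /E -mulrA.
  apply: ler_pM; rewrite ?expR_ge0 ?mulr_ge0 ?expR_ge0 ?(ltW (f_gt0 _))//.
    by rewrite ler_expR; have := Nmono _ _ tT; lra.
  have : expR (2 * N 0) * f 0 * t - expR (2 * N 0) * f 0 * 0 <= Q t - Q 0.
    apply: (@derive_le_increment R (fun s => expR (2 * N 0) * f 0 * s)
      (fun=> expR (2 * N 0) * f 0 * 1) Q (fun s => expR (2 * N s) * f s)) => //.
    move=> s /andP[/ltW s0 _]; rewrite mulr1.
    apply: ler_pM; rewrite ?expR_ge0 ?(ltW (f_gt0 _)) ?f_ndecr//.
    by rewrite ler_expR ler_pM2l// Nmono.
  by rewrite mulr0 subr0.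
Qed.

End Envelope.

(** * Globality in terms of the source g *)

Lemma integral_diverges_eq {R : realType} (h k : R -> R) :
  (forall t, 0 < t -> h t = k t) -> integral_diverges h <-> integral_diverges k.
Proof.
move=> hk; rewrite /integral_diverges.
suff -> : (\int[lebesgue_measure]_(t in `]0%R, +oo[) (h t)%:E =
  \int[lebesgue_measure]_(t in `]0%R, +oo[) (k t)%:E)%E by [].
by apply: eq_integral => t; rewrite inE/= in_itv/= andbT => /hk ->.
Qed.

Section SourceLimit.
Context {R : realType} (g : R -> R) (g_ndecr : {homo g : x y / x <= y}).

Lemma limit_gt0_exists (l : \bar R) : (g t)%:E @[t --> +oo] --> l -> (0 < l)%E ->
  exists t, 0 < g t.
Proof.
move=> gl l0; apply: contrapT => /forallNP ng.
have : (l <= 0)%E.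
  rewrite -(cvg_lim _ gl)//; apply: lime_le; first by apply/cvg_ex; exists l.
  by apply: nearW => t; rewrite lee_fin leNgt; apply/negP; exact: ng.
by rewrite leNgt l0.
Qed.

Lemma le_limit (l : \bar R) t : (g t)%:E @[t --> +oo] --> l -> ((g t)%:E <= l)%E.
Proof.
move=> gl; rewrite -(cvg_lim _ gl)//; apply: lime_ge; first by apply/cvg_ex; exists l.
near=> s; rewrite lee_fin; apply: g_ndecr.
by near: s; apply: nbhs_pinfty_ge; rewrite num_real.
Unshelve. all: by end_near. Qed.

End SourceLimit.

Section Cases.
Context {R : realType} (q c : R) (f g : R -> R) (a : R).
Context (q_gt0 : 0 < q) (q_le2 : q <= 2) (c_ge1 : 1 <= c).
Context (f_cont : continuous f) (f_ndecr : {homo f : x y / x <= y}).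
Context (f_gt0 : forall t, 0 < f t).
Context (g_cont : continuous g) (g_ndecr : {homo g : x y / x <= y}).
Implicit Types (r s t x y : R).

Context (phi : R -> R) (Rr : \bar R) (maxi : is_maximal_solution q c f g a phi Rr).
Let v := derive1 phi.
Let sol : is_solution q c f g a phi Rr := maxi.1.

Let h r := f (phi r) + g (phi r) * v r `^ q.

Let dphi r : 0 < r -> (r%:E < Rr)%E -> is_derive r 1 phi (v r).
Proof. exact: (solution_derive sol). Qed.

Let dv r : 0 < r -> (r%:E < Rr)%E -> is_derive r 1 v (h r - (c - 1) / r * v r).
Proof. exact: (solution_derive2 q_gt0 c_ge1 f_ndecr f_gt0 g_ndecr sol). Qed.

Let v_gt0 r : 0 < r -> (r%:E < Rr)%E -> 0 < v r.
Proof. exact: (solution_derive_gt0 q_gt0 c_ge1 f_ndecr f_gt0 g_ndecr sol). Qed.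

Let phi_ndecr s r : 0 < s -> s <= r -> (r%:E < Rr)%E -> phi s <= phi r.
Proof. exact: (solution_ndecr q_gt0 c_ge1 f_ndecr f_gt0 g_ndecr sol). Qed.

Let phi_unbounded T : exists r, [/\ 0 < r, (r%:E < Rr)%E & T < phi r].
Proof.
exact: (maximal_solution_unbounded q_gt0 q_le2 c_ge1 f_cont f_ndecr f_gt0 g_cont
  g_ndecr T maxi).
Qed.

Let friction_ge0 r : 0 < r -> (r%:E < Rr)%E -> 0 <= (c - 1) / r * v r.
Proof.
by move=> r0 rR; rewrite mulr_ge0 ?(ltW (v_gt0 _ _))// divr_ge0 ?subr_ge0// ltW.
Qed.

Let sub_lt s r : s <= r -> (r%:E < Rr)%E -> (s%:E < Rr)%E.
Proof. by move=> sr; apply: le_lt_trans; rewrite lee_fin. Qed.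

(* Blow-up can only occur by phi reaching +oo, so an a priori bound
   [integrand (phi r) * phi' r <= C] rules it out when the integral diverges. *)
Lemma diverges_global (k : R -> R) (r1 C : R) :
  (forall t, 0 < t -> {for t, continuous k}) -> (forall t, 0 < t -> 0 <= k t) ->
  (forall T, 0 < T -> exists K, forall t, 0 < t <= T -> k t <= K / Num.sqrt t) ->
  0 < r1 -> (r1%:E < Rr)%E -> 0 < phi r1 ->
  (forall r, r1 <= r -> (r%:E < Rr)%E -> k (phi r) * v r <= C) ->
  integral_diverges k -> Rr = +oo%E.
Proof.
move=> ck k0 knear r10 r1R p0 kC div.
move: dphi v_gt0 phi_unbounded phi_ndecr (solution_gt0 sol) r1R kC.
case: Rr => [Rb| |]// dphi' v0 punb pm _ r1R kC; exfalso; move: div.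
apply: (@bounded_interval_not_diverges R k phi v r1 Rb C) => //.
- by move=> r /andP[r1r rR]; apply: dphi' => //; exact: lt_le_trans r1r.
- by move=> r /andP[r1r rR]; apply: v0 => //; exact: lt_le_trans r1r.
- move=> T; have [r [r0 rR Tr]] := punb (Num.max T (phi r1)).
  move: Tr; rewrite gt_max => /andP[Tr pr].
  exists r => //; rewrite -lte_fin rR andbT leNgt; apply/negP => rr1.
  by move: pr; rewrite ltNge pm// ltW.
- by move=> r /andP[r1r rR]; exact: kC.
Qed.

Lemma global_diverges (k : R -> R) (r1 lam kappa : R) : Rr = +oo%E ->
  (forall t, 0 < t -> {for t, continuous k}) -> (forall t, 0 < t -> 0 <= k t) ->
  0 < lam -> 0 < kappa -> 0 < r1 -> 0 < phi r1 ->
  (forall r, r1 <= r -> kappa <= k (lam * phi r) * v r) -> integral_diverges k.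
Proof.
move=> Roo ck k0 lam0 kap0 r10 p0 kv.
apply: (@global_growth_diverges R k phi v r1 lam kappa) => //.
- by move=> r r1r; apply: dphi; [exact: lt_le_trans r1r|rewrite Roo ltry].
- by move=> r r1r; apply: v_gt0; [exact: lt_le_trans r1r|rewrite Roo ltry].
Qed.

(** * Source positive somewhere: the criterion in (i) *)

Section PositiveSource.
Context (tg : R) (gtg : 0 < g tg).

Let denom t := Num.sqrt (t * f t) + (t * posp g t) `^ (1 / (2 - q)).

Lemma denom_gt0 t : 0 < t -> 0 < denom t.
Proof.
by move=> t0; rewrite /denom ltr_wpDr ?powR_ge0// sqrtr_gt0 mulr_gt0.
Qed.

Lemma integrand_i_continuous t : q < 2 -> 0 < t -> {for t, continuous (integrand_i q f g)}.
Proof.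
move=> q2 t0; apply: continuous_inv; first by rewrite gt_eqF// denom_gt0.
apply: continuous_add.
  apply: continuous_sqrt_gt0; last by rewrite mulr_gt0.
  by apply: continuous_mul; [exact: continuous_ident|exact: f_cont].
apply: (@continuous_powR_ge0 _ _ _ _ t) => //; first by rewrite divr_gt0// subr_gt0.
  apply: continuous_mul; first exact: continuous_ident.
  by apply: continuous_maxf; [exact: g_cont|exact: continuous_const].
move=> y; rewrite ltr_distl => yt.
by rewrite mulr_ge0 ?/posp ?le_max ?lexx ?orbT//; lra.
Qed.

Lemma integrand_i_ge0 t : 0 < t -> 0 <= integrand_i q f g t.
Proof. by move=> t0; rewrite invr_ge0 ltW// denom_gt0. Qed.

Lemma integrand_i_near0 T : 0 < T ->
  exists K, forall t, 0 < t <= T -> integrand_i q f g t <= K / Num.sqrt t.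
Proof.
move=> _; exists (Num.sqrt (f 0))^-1 => t /andP[t0 _].
have st : 0 < Num.sqrt t by rewrite sqrtr_gt0.
have s0 : 0 < Num.sqrt (f 0) by rewrite sqrtr_gt0.
rewrite /integrand_i -/(denom t) -invfM lef_pV2 ?posrE ?denom_gt0 ?mulr_gt0//.
rewrite -sqrtrM ?(ltW (f_gt0 _))//.
apply: (@le_trans _ _ (Num.sqrt (t * f t))); last by rewrite /denom lerDl powR_ge0.
by rewrite ler_wsqrtr// mulrC ler_pM2l// f_ndecr// ltW.
Qed.

Lemma phi_large T : exists r1, [/\ 0 < r1, (r1%:E < Rr)%E, 1 <= phi r1, T <= phi r1 &
  tg <= phi r1].
Proof.
have [r [r0 rR]] := phi_unbounded (Num.max 1 (Num.max T tg)).
rewrite !gt_max => /and3P[h1 h2 h3].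
by exists r; split => //; exact: ltW.
Qed.

(** Let V be the maximum of [v] on [r1, r] and t = phi r. Integrating (v^2)' gives V^2 <= v(r1)^2 +
    2 t (f t + g t V^q), and for q <= 1 this forces V to be at most a multiple of [denom t]. *)
Lemma diverges_global_pos : q <= 1 -> integral_diverges (integrand_i q f g) -> Rr = +oo%E.
Proof.
move=> q1 div; have [r1 [r10 r1R p1 _ ptg]] := phi_large 0.
(* The quotient absorbs the initial speed, since f 1 <= denom t ^ 2; the summand 2 absorbs 2 t f(t).
   The later + 2 accounts for the [g] term. *)
pose K := v r1 ^+ 2 / f 1 + 2.
have f1 := f_gt0 1.
have K2 : 2 <= K by rewrite /K lerDr divr_ge0 ?sqr_ge0// ltW.
apply: (@diverges_global (integrand_i q f g) r1 (K + 2)) => //.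
- by move=> t t0; apply: integrand_i_continuous => //; lra.
- exact: integrand_i_ge0.
- exact: integrand_i_near0.
- by lra.
move=> r r1r rR; pose t := phi r.
have r0 : 0 < r by exact: lt_le_trans r1r.
have xR x : x <= r -> (x%:E < Rr)%E by move=> xr; exact: sub_lt rR.
have t1 : 1 <= t by apply: le_trans p1 _; exact: phi_ndecr.
have t0 : 0 < t by lra.
have gt0 : 0 < g t.
  by apply: lt_le_trans gtg _; apply: g_ndecr; apply: le_trans ptg _; exact: phi_ndecr.
have S0 := denom_gt0 t0.
(* [v] need not be monotone; its maximum bounds v^q by one constant throughout the integration. *)
have [s sr vmax] : exists2 s, r1 <= s <= r & forall x, r1 <= x <= r -> v x <= v s.
  have [|s sr vmax] := @EVT_max R v r1 r r1r.
    apply: continuous_within_segment => x /andP[r1x xr].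
    by apply: is_derive_continuous (dv _ _); [exact: lt_le_trans r1x|exact: xR].
  exists s; first by move: sr; rewrite in_itv.
  by move=> x xr; apply: vmax; rewrite in_itv.
have /andP[r1s s_r] := sr; have s0 : 0 < s by exact: lt_le_trans r1s.
pose V := v s; have V0 : 0 < V by apply: v_gt0 => //; exact: xR.
pose M := f t + g t * V `^ q.
have M0 : 0 <= M by rewrite /M addr_ge0 ?(ltW (f_gt0 _))// mulr_ge0 ?powR_ge0// ltW.
have Vbound : V ^+ 2 <= v r1 ^+ 2 + 2 * (t * M).
  have : V ^+ 2 - v r1 ^+ 2 <= 2 * M * phi s - 2 * M * phi r1.
    apply: (@derive_le_increment R (fun x => v x ^+ 2)
      (fun x => 2 * v x * (h x - (c - 1) / x * v x))
      (fun x => 2 * M * phi x) (fun x => 2 * M * v x) r1 s r1s).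
    - move=> x /andP[r1x xs]; apply: is_derive_sqr; apply: dv.
        exact: lt_le_trans r1x.
      by apply: xR; exact: le_trans s_r.
    - move=> x /andP[r1x xs]; apply: is_derive_scale; apply: dphi.
        exact: lt_le_trans r1x.
      by apply: xR; exact: le_trans s_r.
    - move=> x /andP[/ltW r1x /ltW xs].
      have x0 : 0 < x by exact: lt_le_trans r1x.
      have xr : x <= r by exact: le_trans s_r.
      have vx := v_gt0 x0 (xR _ xr); have pt : phi x <= t by exact: phi_ndecr.
      rewrite -!mulrA ler_pM2l// [leRHS]mulrC ler_pM2l//.
      have fr := friction_ge0 x0 (xR _ xr).
      have fx : f (phi x) <= f t by exact: f_ndecr.
      have vq : v x `^ q <= V `^ q.
        apply: ge0_ler_powR; rewrite ?nnegrE ?(ltW q_gt0) ?(ltW vx) ?(ltW V0)//.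
        by apply: vmax; rewrite r1x.
      have gx : g (phi x) * v x `^ q <= g t * V `^ q.
        apply: (@le_trans _ _ (g t * v x `^ q)).
          by rewrite ler_wpM2r ?powR_ge0// g_ndecr.
        by rewrite ler_wpM2l// ltW.
      rewrite /h lerBlDr; apply: (le_trans (lerD fx gx)).
      by rewrite -/M lerDl mulrA.
  have ps : phi s - phi r1 <= t.
    have : phi s <= t by exact: phi_ndecr.
    by lra.
  have : M * (phi s - phi r1) <= M * t by rewrite ler_wpM2l.
  by rewrite /V; lra.
have posE : posp g t = g t by rewrite /posp max_l// ltW.
have p2q : 0 < 2 - q by lra.
have St : t * f t <= denom t ^+ 2.
  rewrite -[leLHS]sqr_sqrtr; last by rewrite mulr_ge0 ?(ltW (f_gt0 _))// ltW.
  rewrite ler_sqr ?nnegrE ?sqrtr_ge0 ?(ltW S0)//.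
  by rewrite /denom lerDl powR_ge0.
have Sg : t * g t <= denom t `^ (2 - q).
  have tg0 : 0 <= t * g t by rewrite mulr_ge0 ?ltW.
  rewrite -[leLHS](powR_invK p2q tg0).
  apply: ge0_ler_powR; rewrite ?nnegrE ?powR_ge0 ?(ltW p2q) ?(ltW S0)//.
  by rewrite /denom posE div1r lerDr sqrtr_ge0.
have S1 : f 1 <= denom t ^+ 2.
  apply: le_trans St; apply: (@le_trans _ _ (1 * f t)).
    by rewrite mul1r; exact: f_ndecr.
  by rewrite ler_pM2r.
have Vle : V <= (K + 2) * denom t.
  have [VS|SV] := leP V (denom t).
    by apply: le_trans VS _; rewrite ler_peMl ?(ltW S0)//; lra.
  (* With S = denom t < V, the condition q <= 1 gives S^(1-q) <= V^(1-q), which makes the [g] term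
     linear in V. *)
  have key : denom t `^ (2 - q) * V `^ q <= denom t * V.
    have -> : denom t `^ (2 - q) = denom t * denom t `^ (1 - q).
      rewrite -{2}[denom t](powRr1 (ltW S0)) -powRD; last by apply/implyP => _; rewrite gt_eqF.
      by congr (_ `^ _); lra.
    rewrite -mulrA ler_pM2l//.
    have VE : V = V `^ (1 - q) * V `^ q.
      rewrite -powRD; last by apply/implyP => _; rewrite gt_eqF.
      by rewrite subrK powRr1// ltW.
    rewrite [leRHS]VE ler_wpM2r ?powR_ge0//.
    by apply: ge0_ler_powR; rewrite ?nnegrE ?subr_ge0 ?(ltW S0) ?(ltW V0)// ltW.
  have v1 : v r1 ^+ 2 <= v r1 ^+ 2 / f 1 * denom t ^+ 2.
    rewrite -mulrA ler_peMr ?sqr_ge0//.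
    by rewrite mulrC ler_pdivlMr// mul1r.
  have gV : t * g t * V `^ q <= denom t * V.
    by apply: le_trans key; rewrite ler_wpM2r ?powR_ge0.
  have SSV : denom t ^+ 2 <= denom t * V by rewrite expr2 ler_pM2l// ltW.
  have V2 : V ^+ 2 <= (K + 2) * (denom t * V).
    have KSV : K * denom t ^+ 2 <= K * (denom t * V) by rewrite ler_wpM2l//; lra.
    by move: Vbound St v1 gV KSV; rewrite /M {1}/K mulrDl mulrDr; lra.
  by rewrite -(ler_pM2r V0) -expr2 -mulrA.
rewrite -[integrand_i q f g (phi r)]/((denom t)^-1) mulrC ler_pdivrMr//.
by apply: le_trans Vle; apply: vmax; rewrite r1r lexx.
Qed.

(** * Necessary conditions for a global solution with positive source *)

Section Global.
Context (Roo : Rr = +oo%E).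

Let inR r : (r%:E < Rr)%E. Proof. by rewrite Roo ltry. Qed.

(** Eventually v' >= (g0 / 2) v^q. If q > 1, the positive function v^(1-q) decreases at least at the
    fixed rate [k], hence becomes negative in finite time. *)
Lemma global_pos_exponent_le1 : q <= 1.
Proof.
rewrite leNgt; apply/negP => q1.
have [r1 [r10 _ _ _ ptg]] := phi_large 0.
pose g0 := g (phi r1); pose f0 := f (phi r1).
have g00 : 0 < g0 by apply: lt_le_trans gtg _; exact: g_ndecr.
have f00 : 0 < f0 by exact: f_gt0.
pose d := Num.min f0 g0; have d0 : 0 < d by rewrite lt_min f00.
have df : d <= f0 by rewrite ge_min lexx.
have dg : d <= g0 by rewrite ge_min lexx orbT.
(* From [r2] on, (c - 1)/r <= d/2, so friction takes at most half of the source: d v <= f0 when v <=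
   1, and d v <= g0 v^q when v >= 1 and q > 1. *)
pose r2 := r1 + 2 * (c - 1) / d.
have r12 : r1 <= r2 by rewrite /r2 lerDl divr_ge0 ?(ltW d0)// mulr_ge0 ?subr_ge0.
have r20 : 0 < r2 by exact: lt_le_trans r12.
have vgrow r : r2 <= r -> g0 / 2 * v r `^ q <= h r - (c - 1) / r * v r.
  move=> r2r; have r0 : 0 < r by exact: lt_le_trans r2r.
  have vr := v_gt0 r0 (inR r).
  have pr : phi r1 <= phi r by apply: phi_ndecr => //; exact: le_trans r2r.
  have fr : f0 <= f (phi r) by exact: f_ndecr.
  have vq0 : 0 <= v r `^ q by exact: powR_ge0.
  have gr : g0 * v r `^ q <= g (phi r) * v r `^ q.
    by rewrite ler_wpM2r//; exact: g_ndecr.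
  have dfric : (c - 1) / r * v r <= d / 2 * v r.
    rewrite ler_pM2r// ler_pdivrMr//.
    have : d / 2 * r2 <= d / 2 * r by rewrite ler_pM2l//; lra.
    have -> : d / 2 * r2 = d / 2 * r1 + (c - 1) by rewrite /r2; field; rewrite gt_eqF.
    have : 0 <= d / 2 * r1 by rewrite mulr_ge0//; lra.
    by lra.
  have dv' : d * v r <= f0 + g0 * v r `^ q.
    have [v1|/ltW v1] := leP (v r) 1.
      have : d * v r <= d * 1 by rewrite ler_pM2l.
      have : 0 <= g0 * v r `^ q by rewrite mulr_ge0// ltW.
      by lra.
    have : v r <= v r `^ q by apply: le1r_powR => //; exact: ltW.
    move=> vvq; have : d * v r <= g0 * v r `^ q.
      by apply: ler_pM => //; exact: ltW.
    by lra.
  by rewrite /h; lra.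
pose k := (q - 1) * (g0 / 2).
have k0 : 0 < k by rewrite /k mulr_gt0 ?divr_gt0 ?subr_gt0.
pose r := r2 + (v r2 `^ (1 - q) + 1) / k.
have r2r : r2 <= r by rewrite /r lerDl divr_ge0 ?(ltW k0)// addr_ge0 ?powR_ge0.
have : v r `^ (1 - q) - v r2 `^ (1 - q) <= - k * r - - k * r2.
  apply: (@derive_le_increment R (fun x => v x `^ (1 - q))
    (fun x => (1 - q) * v x `^ (1 - q - 1) * (h x - (c - 1) / x * v x))
    (fun x => - k * x) (fun=> - k * 1)) => //.
  - move=> x /andP[r2x _]; have x0 : 0 < x by exact: lt_le_trans r2x.
    apply: (is_derive_chain (is_derive1_powR (1 - q) (v_gt0 x0 (inR x)))).
    exact: dv.
  - move=> x /andP[/ltW r2x _]; have x0 : 0 < x by exact: lt_le_trans r2x.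
    have vx := v_gt0 x0 (inR x).
    have P0 : 0 < v x `^ (1 - q - 1) by exact: powR_gt0.
    have PE : v x `^ (1 - q - 1) * v x `^ q = 1.
      rewrite -powRD; last by apply/implyP => _; rewrite gt_eqF.
      by rewrite (_ : 1 - q - 1 + q = 0) ?powRr0//; ring.
    have := vgrow _ r2x; rewrite -(ler_pM2l P0) mulrCA PE mulr1.
    have q10 : 0 <= q - 1 by lra.
    by move=> /(ler_wpM2l q10); rewrite /k; lra.
have := powR_ge0 (v r) (1 - q).
have -> : - k * r - - k * r2 = - (v r2 `^ (1 - q) + 1) by rewrite /r; field; rewrite gt_eqF.
by move: (v r `^ _) (v r2 `^ _) => x y; lra.
Qed.

Lemma rhs_continuous r : 0 < r -> {for r, continuous h}.
Proof.
move=> r0; have cp := is_derive_continuous (dphi r0 (inR r)).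
have cv := is_derive_continuous (dv r0 (inR r)).
apply: continuous_add; first by apply: continuous_compf => //; exact: f_cont.
apply: continuous_mul; first by apply: continuous_compf => //; exact: g_cont.
by apply: continuous_powR_gt0 => //; exact: v_gt0.
Qed.

(* [K = 1 / (c - 1/2)]: any constant strictly between 1/c and 1/(c-1) makes
   v/r decreasing where v/r > K h, while v/r <= K h keeps v' >= (1 - (c-1)K) h. *)
Lemma friction_eventually_le : q <= 1 -> let K := (c - 2^-1)^-1 in
  exists r2, [/\ 0 < r2, tg <= phi r2, 1 <= phi r2 & forall r, r2 <= r -> v r / r <= K * h r].
Proof.
move=> q1 K; have [r1 [r10 _ p1 _ ptg]] := phi_large 0.
have cK : 0 < c - 2^-1 :> R.
  by rewrite subr_gt0 (lt_le_trans _ c_ge1)// invf_lt1 ?ltr1n.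
have K0 : 0 < K by rewrite invr_gt0.
have KE x : x = (c - 2^-1) * (K * x) by rewrite mulrA mulfV ?gt_eqF// mul1r.
pose f0 := f (phi r1); have f00 : 0 < f0 by exact: f_gt0.
have g_gt0 r : r1 <= r -> 0 < g (phi r).
  move=> r1r; apply: lt_le_trans gtg _; apply: g_ndecr; apply: le_trans ptg _.
  exact: phi_ndecr.
have hf r : r1 <= r -> f0 <= h r.
  move=> r1r; have fr : f0 <= f (phi r) by apply: f_ndecr; exact: phi_ndecr.
  have : 0 <= g (phi r) * v r `^ q by rewrite mulr_ge0 ?powR_ge0// ltW// g_gt0.
  by rewrite /h; lra.
have dz r : 0 < r -> is_derive r 1 (fun x => v x * x^-1)
    (v r * (- r ^- 2 * 1) + r^-1 * (h r - (c - 1) / r * v r)).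
  move=> r0; apply: is_derive_mul; first exact: dv.
  by apply: (is_deriveV (f := fun x : R => x)); rewrite ?gt_eqF.
(* If the relation never held, v^2/r would be nonincreasing, its derivative being (2 v / r)(h - (c -
   1/2) v/r). But v/r > K f0 makes v^2/r grow at least linearly. *)
have [r2 [r12 start]] : exists r2, r1 <= r2 /\ v r2 / r2 <= K * h r2.
  apply: contrapT => /forallNP nstart.
  have viol r : r1 <= r -> K * h r < v r / r.
    by move=> r1r; rewrite ltNge; apply/negP => le; apply: (nstart r).
  pose C := v r1 ^+ 2 / r1.
  have vsq r : r1 <= r -> v r ^+ 2 / r <= C.
    move=> r1r; apply: (@derive_nonpos_ge R (fun x => v x ^+ 2 * x^-1)
      (fun x => v x ^+ 2 * (- x ^- 2 * 1) +
        x^-1 * (2 * v x * (h x - (c - 1) / x * v x))) r1 r r1r).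
      move=> x /andP[r1x _]; have x0 : 0 < x by exact: lt_le_trans r1x.
      apply: is_derive_mul; first by apply: is_derive_sqr; exact: dv.
      by apply: (is_deriveV (f := fun x : R => x)); rewrite ?gt_eqF.
    move=> x /andP[/ltW r1x _]; have x0 : 0 < x by exact: lt_le_trans r1x.
    have vx := v_gt0 x0 (inR x).
    have -> : v x ^+ 2 * (- x ^- 2 * 1) + x^-1 * (2 * v x * (h x - (c - 1) / x * v x)) =
        2 * v x / x * (h x - (c - 2^-1) * (v x / x)) by field; rewrite gt_eqF.
    rewrite mulr_ge0_le0 ?divr_ge0 ?mulr_ge0 ?(ltW vx) ?(ltW x0)// subr_le0.
    by rewrite {1}[h x]KE ler_pM2l// ltW// viol.
  pose D := (K * f0) ^+ 2; have D0 : 0 < D by rewrite exprn_gt0// mulr_gt0.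
  have C0 : 0 <= C by rewrite divr_ge0 ?sqr_ge0// ltW.
  pose r := r1 + (C + 1) / D.
  have r1r : r1 <= r by rewrite /r lerDl divr_ge0 ?(ltW D0)//; lra.
  have r0 : 0 < r by exact: lt_le_trans r1r.
  have vr := v_gt0 r0 (inR r).
  have low : K * f0 * r <= v r.
    rewrite -ler_pdivlMr//; apply: le_trans (ltW (viol _ r1r)).
    by rewrite ler_pM2l// hf.
  have : D * r <= v r ^+ 2 / r.
    rewrite ler_pdivlMr// (_ : D * r * r = (K * f0 * r) ^+ 2); last by rewrite /D; ring.
    by rewrite ler_sqr ?nnegrE ?(ltW vr)// !mulr_ge0 ?ltW.
  have -> : D * r = D * r1 + (C + 1) by rewrite /r; field; rewrite gt_eqF.
  have := vsq _ r1r; have : 0 < D * r1 by exact: mulr_gt0.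
  by lra.
have r20 : 0 < r2 by exact: lt_le_trans r12.
have p12 : phi r1 <= phi r2 by exact: phi_ndecr.
exists r2; split; [exact: r20|exact: le_trans p12|exact: le_trans p12|].
move=> r r2r; rewrite leNgt; apply/negP => bad.
have r0 : 0 < r by exact: lt_le_trans r2r.
(* Persistence: after the last contact point [s], the relation v/r > K h makes v/r decrease. *)
have [|||s [r2s sr Ds Dpos]] := @last_crossing R (fun x => v x * x^-1 - K * h x) r2 r r2r.
- move=> x /andP[r2x _]; have x0 : 0 < x by exact: lt_le_trans r2x.
  apply: continuous_sub; first exact: is_derive_continuous (dz _ x0).
  by apply: continuous_mul; [exact: continuous_const|exact: rhs_continuous].
- by rewrite subr_le0.
- by rewrite subr_gt0.
have s0 : 0 < s by exact: lt_le_trans r2s.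
have vs := v_gt0 s0 (inR s); have vr := v_gt0 r0 (inR r).
have zdecr : v r / r <= v s / s.
  apply: (derive_nonpos_ge (ltW sr) (f := fun x => v x * x^-1)).
    by move=> x /andP[sx _]; apply: dz; exact: lt_le_trans sx.
  move=> x /andP[sx xr]; have x0 : 0 < x by exact: lt_trans sx.
  have vx := v_gt0 x0 (inR x).
  have -> : v x * (- x ^- 2 * 1) + x^-1 * (h x - (c - 1) / x * v x) =
      x^-1 * (h x - c * (v x / x)) by field; rewrite gt_eqF.
  have : h x <= (c - 2^-1) * (v x / x).
    by rewrite {1}[h x]KE ler_pM2l// ltW// -subr_gt0 Dpos// sx ltW.
  have vx0 : 0 < v x / x by rewrite divr_gt0.
  move=> hx; rewrite mulr_ge0_le0 ?invr_ge0 ?(ltW x0)// subr_le0.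
  by apply: le_trans hx _; rewrite ler_pM2r// lerBlDr lerDl invr_ge0.
(* [lam] is the factor by which v/r has dropped since [s]. As lam v(s) <= v(r) and, for q <= 1, lam
   <= lam^q, the source has dropped by no smaller a factor, so the relation at [s] carries over to
   r. *)
pose lam := (v r / r) / (v s / s).
have zr0 : 0 < v r / r by rewrite divr_gt0.
have zs0 : 0 < v s / s by rewrite divr_gt0.
have lam0 : 0 < lam by rewrite divr_gt0.
have lam1 : lam <= 1 by rewrite ler_pdivrMr// mul1r.
have r1s : r1 <= s by exact: le_trans r2s.
have psr : phi s <= phi r by apply: phi_ndecr => //; exact: ltW.
have hlam : lam * h s <= h r.
  have fsr : f (phi s) <= f (phi r) by exact: f_ndecr.
  have lf : lam * f (phi s) <= f (phi s) by rewrite ler_piMl// ltW.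
  have lvs : lam * v s <= v r.
    have -> : lam * v s = v r / r * s by rewrite /lam; field; rewrite !gt_eqF.
    by rewrite mulrAC ler_pdivrMr// ler_pM2l// ltW.
  have vq : lam * v s `^ q <= v r `^ q.
    apply: (@le_trans _ _ ((lam * v s) `^ q)).
      rewrite powRM ?(ltW lam0) ?(ltW vs)// ler_wpM2r ?powR_ge0//.
      by apply: ger1_powR => //; rewrite lam0.
    have lvs0 : 0 <= lam * v s by rewrite mulr_ge0// ltW.
    by apply: (ge0_ler_powR (ltW q_gt0)); rewrite ?nnegrE// ltW.
  have gs := g_gt0 _ r1s.
  have gg : g (phi s) * (lam * v s `^ q) <= g (phi r) * v r `^ q.
    apply: ler_pM => //; [exact: ltW|by rewrite mulr_ge0 ?powR_ge0// ltW|exact: g_ndecr].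
  rewrite /h mulrDr; apply: lerD; first exact: le_trans lf fsr.
  by rewrite mulrCA.
have Khs : K * h s = v s / s by apply/eqP; rewrite eq_sym -subr_eq0 Ds.
have : lam * (v s / s) <= K * h r by rewrite -Khs mulrCA ler_pM2l.
by rewrite /lam divfK ?gt_eqF// leNgt bad.
Qed.

(** With v' >= kap h, integrate v^2 and v^(2-q) from the point where phi equals t = phi(r)/2. The
    increment of phi is again t, and [v] dominates both summands of the denominator at t. *)
Lemma global_pos_diverges : integral_diverges (integrand_i q f g).
Proof.
have q1 := global_pos_exponent_le1.
have [r2 [r20 ptg p1 fric]] := friction_eventually_le q1.
set K := (c - 2^-1)^-1 in fric.
have cK : 0 < c - 2^-1 :> R.
  by rewrite subr_gt0 (lt_le_trans _ c_ge1)// invf_lt1 ?ltr1n.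
have K0 : 0 < K by rewrite invr_gt0.
(* This is what friction leaves: 1 - (c - 1) K = K/2 for K = 1 / (c - 1/2). *)
pose kap := 2^-1 * K; have kap0 : 0 < kap by rewrite mulr_gt0// invr_gt0.
have g_gt0 r : r2 <= r -> 0 < g (phi r).
  move=> r2r; apply: lt_le_trans gtg _; apply: g_ndecr; apply: le_trans ptg _.
  exact: phi_ndecr.
have vgrow r : r2 <= r -> kap * h r <= h r - (c - 1) / r * v r.
  move=> r2r; have r0 : 0 < r by exact: lt_le_trans r2r.
  have c10 : 0 <= c - 1 by rewrite subr_ge0.
  have := ler_wpM2l c10 (fric _ r2r).
  have -> : (c - 1) * (v r / r) = (c - 1) / r * v r by field; rewrite gt_eqF.
  have -> : kap * h r = h r - (c - 1) * (K * h r).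
    by rewrite /kap /K; field; rewrite gt_eqF// -subr_gt0; lra.
  by lra.
have [r3' [r3'0 _ p3']] := phi_unbounded (2 * phi r2).
(* From [r3] on, half the level phi(r) is at least phi(r2), so it is attained where the growth
   estimate is valid. *)
pose r3 := Num.max r2 r3'.
have r23 : r2 <= r3 by rewrite le_max lexx.
have p3 : 2 * phi r2 <= phi r3.
  by apply: le_trans (ltW p3') _; apply: phi_ndecr => //; rewrite le_max lexx orbT.
have r30 : 0 < r3 by exact: lt_le_trans r23.
have p2q : 0 < 2 - q by lra.
pose C1 := Num.sqrt (2 * kap); pose C2 := ((2 - q) * kap) `^ (1 / (2 - q)).
have C10 : 0 < C1 by rewrite sqrtr_gt0 mulr_gt0.
have C20 : 0 < C2 by rewrite powR_gt0// mulr_gt0.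
have C0 : 0 < C1^-1 + C2^-1 by rewrite addr_gt0 ?invr_gt0.
apply: (@global_diverges (integrand_i q f g) r3 2^-1 (C1^-1 + C2^-1)^-1) => //.
- by move=> t t0; apply: integrand_i_continuous => //; lra.
- exact: integrand_i_ge0.
- by rewrite invr_gt0.
- by lra.
move=> r r3r; have r0 : 0 < r by exact: lt_le_trans r3r.
have r2r : r2 <= r by exact: le_trans r3r.
have pr : phi r3 <= phi r by exact: phi_ndecr.
pose t := 2^-1 * phi r; have t0 : 0 < t by rewrite /t; lra.
have [||s /andP[r2s sr] ps] := @intermediate_value R phi r2 r t r2r.
- move=> x /andP[r2x _]; apply: is_derive_continuous (dphi _ (inR x)).
  exact: lt_le_trans r2x.
- by rewrite /t; lra.
have s0 : 0 < s by exact: lt_le_trans r2s.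
have vr := v_gt0 r0 (inR r).
have gt0 : 0 < g t by rewrite -ps; exact: g_gt0.
have phiE : phi r = 2 * t by rewrite /t; field.
have mono x : s <= x -> f t <= f (phi x) /\ g t <= g (phi x).
  by move=> sx; rewrite -ps; split; [apply: f_ndecr|apply: g_ndecr]; exact: phi_ndecr.
have bound_f : C1 * Num.sqrt (t * f t) <= v r.
  have : 2 * kap * f t * phi r - 2 * kap * f t * phi s <= v r ^+ 2 - v s ^+ 2.
    apply: (@derive_le_increment R (fun x => 2 * kap * f t * phi x)
      (fun x => 2 * kap * f t * v x) (fun x => v x ^+ 2)
      (fun x => 2 * v x * (h x - (c - 1) / x * v x)) s r sr).
    - move=> x /andP[sx _]; apply: is_derive_scale; apply: dphi => //.
      exact: lt_le_trans sx.
    - move=> x /andP[sx _]; apply: is_derive_sqr; apply: dv => //.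
      exact: lt_le_trans sx.
    - move=> x /andP[/ltW sx _]; have x0 : 0 < x by exact: lt_le_trans sx.
      have r2x : r2 <= x by exact: le_trans sx.
      have vx := v_gt0 x0 (inR x); have [fx gx] := mono _ sx.
      have -> : 2 * kap * f t * v x = 2 * v x * (kap * f t) by ring.
      rewrite ler_pM2l ?mulr_gt0//; apply: le_trans (vgrow _ r2x); rewrite ler_pM2l//.
      have : 0 <= g (phi x) * v x `^ q by rewrite mulr_ge0 ?powR_ge0// ltW// g_gt0.
      by rewrite /h; lra.
  rewrite ps phiE => H.
  have vs2 : 0 <= v s ^+ 2 by exact: sqr_ge0.
  rewrite /C1 -sqrtrM; last by rewrite mulr_ge0// ltW.
  rewrite -[leRHS]ger0_norm ?(ltW vr)// -sqrtr_sqr; apply: ler_wsqrtr.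
  by lra.
have bound_g : C2 * (t * g t) `^ (1 / (2 - q)) <= v r.
  have : (2 - q) * kap * g t * phi r - (2 - q) * kap * g t * phi s <=
      v r `^ (2 - q) - v s `^ (2 - q).
    apply: (@derive_le_increment R (fun x => (2 - q) * kap * g t * phi x)
      (fun x => (2 - q) * kap * g t * v x) (fun x => v x `^ (2 - q))
      (fun x => (2 - q) * v x `^ (2 - q - 1) * (h x - (c - 1) / x * v x)) s r sr).
    - move=> x /andP[sx _]; apply: is_derive_scale; apply: dphi => //.
      exact: lt_le_trans sx.
    - move=> x /andP[sx _]; have x0 : 0 < x by exact: lt_le_trans sx.
      apply: (is_derive_chain (is_derive1_powR (2 - q) (v_gt0 x0 (inR x)))).
      exact: dv.
    - move=> x /andP[/ltW sx _]; have x0 : 0 < x by exact: lt_le_trans sx.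
      have r2x : r2 <= x by exact: le_trans sx.
      have vx := v_gt0 x0 (inR x); have [fx gx] := mono _ sx.
      have P0 : 0 < v x `^ (2 - q - 1) by exact: powR_gt0.
      have PE : v x `^ (2 - q - 1) * v x `^ q = v x.
        rewrite -powRD; last by apply/implyP => _; rewrite gt_eqF.
        by rewrite (_ : 2 - q - 1 + q = 1) ?powRr1 ?(ltW vx)//; ring.
      have -> : (2 - q) * kap * g t * v x =
          (2 - q) * v x `^ (2 - q - 1) * (kap * (g t * v x `^ q)).
        transitivity ((2 - q) * kap * g t * (v x `^ (2 - q - 1) * v x `^ q)).
          by rewrite PE.
        by ring.
      rewrite ler_pM2l ?mulr_gt0//; apply: le_trans (vgrow _ r2x); rewrite ler_pM2l//.
      have : g t * v x `^ q <= g (phi x) * v x `^ q by rewrite ler_wpM2r ?powR_ge0.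
      by have := f_gt0 (phi x); rewrite /h; lra.
  rewrite ps phiE => H.
  have vs2 := powR_ge0 (v s) (2 - q).
  have tg0 : 0 <= t * g t by rewrite mulr_ge0 ?ltW.
  have k0 : 0 <= (2 - q) * kap by rewrite mulr_ge0 ?ltW.
  have vE : v r = (v r `^ (2 - q)) `^ (1 / (2 - q)).
    by rewrite -powRrM div1r mulfV ?gt_eqF// powRr1// ltW.
  rewrite /C2 -powRM// vE.
  have e0 : 0 <= 1 / (2 - q) by rewrite divr_ge0// ltW.
  have x0 : 0 <= (2 - q) * kap * (t * g t) by exact: mulr_ge0.
  apply: (ge0_ler_powR e0); rewrite ?nnegrE; [exact: x0|exact: powR_ge0|].
  by move: H vs2; move: (v r `^ _) (v s `^ _) => y z; lra.
rewrite -[integrand_i q f g _]/((denom t)^-1) mulrC.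
have S0 := denom_gt0 t0.
rewrite ler_pdivlMr// mulrC ler_pdivrMr// /denom /posp max_l ?(ltW gt0)//.
rewrite mulrDr; apply: lerD; last by rewrite ler_pdivlMr// mulrC.
by rewrite ler_pdivlMr// mulrC.
Qed.

End Global.
End PositiveSource.

(** * Nonpositive source: comparison of v^2 with the envelope *)

Section NegativeSource.
Context (g_le0 : forall t, g t <= 0).

Let X r := negp g (phi r) / f (phi r) * v r `^ q.
Let p := 2 / q.

Let p_ge1 : 1 <= p. Proof. by rewrite /p ler_pdivlMr// mul1r. Qed.

Let X_ge0 r : 0 <= X r.
Proof. by rewrite /X mulr_ge0 ?powR_ge0// divr_ge0 ?negp_ge0// ltW. Qed.

Let h_eq r : h r = f (phi r) * (1 - X r).
Proof.
rewrite /h /X /negp max_l ?oppr_ge0//; field.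
by rewrite gt_eqF.
Qed.

Let damping_eq r : 0 < r -> (r%:E < Rr)%E ->
  damping q f g (phi r) * v r ^+ 2 = f (phi r) * X r `^ p.
Proof.
move=> r0 rR; rewrite /X powRM ?powR_ge0 ?divr_ge0 ?negp_ge0 ?(ltW (f_gt0 _))//.
have -> : (v r `^ q) `^ p = v r ^+ 2.
  rewrite -powRrM -powR_mulrn ?(ltW (v_gt0 _ _))//; congr (_ `^ _).
  by rewrite /p; field; rewrite gt_eqF.
by rewrite /damping -/p; ring.
Qed.

(** Dropping g <= 0 and using that f(phi) is nondecreasing, integrate (r^(c-1) v)' <= r^(c-1) f(phi)
    from the origin. Friction then takes at most the fraction 1 - 1/c of f(phi). *)
Lemma friction_le_source r : 0 < r -> (r%:E < Rr)%E -> v r / r <= f (phi r) / c.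
Proof.
move=> r0 rR; have c0 : 0 < c by exact: lt_le_trans c_ge1.
pose F := f (phi r); have rc0 : 0 < r `^ (c - 1) by exact: powR_gt0.
rewrite -(ler_pM2l rc0) -(ler_pM2r r0) mulrA divfK ?gt_eqF//.
apply/ler_addgt0Pr => e e0.
have [d d0 hd] := friction_weight_near0 c_ge1 sol e0.
(* The equation is only available for r > 0, so integration starts where r^(c-1) v is below [e]. *)
pose s := Num.min d r / 2.
have m0 : 0 < Num.min d r by rewrite lt_min d0.
have m1 : Num.min d r <= d by rewrite ge_min lexx.
have m2 : Num.min d r <= r by rewrite ge_min lexx orbT.
have s0 : 0 < s by rewrite divr_gt0.
have sd : s < d by rewrite /s; lra.
have sr : s <= r by rewrite /s; lra.
have ys : s `^ (c - 1) * v s < e.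
  by apply: le_lt_trans (ler_norm _) _; apply: hd; rewrite s0.
have incr : r `^ (c - 1) * v r - s `^ (c - 1) * v s <= F / c * r `^ c - F / c * s `^ c.
  apply: (@derive_le_increment R (fun x => x `^ (c - 1) * v x)
    (fun x => x `^ (c - 1) * h x) (fun x => F / c * x `^ c)
    (fun x => F / c * (c * x `^ (c - 1))) s r sr).
  - move=> x /andP[sx xr]; have x0 : 0 < x by exact: lt_le_trans sx.
    by apply: (powR_friction_derive x0); apply: dv => //; exact: sub_lt rR.
  - move=> x /andP[sx xr]; apply: is_derive_scale; apply: is_derive1_powR.
    exact: lt_le_trans sx.
  - move=> x /andP[/ltW sx /ltW xr].
    have -> : F / c * (c * x `^ (c - 1)) = x `^ (c - 1) * F by field; rewrite gt_eqF.
    rewrite ler_wpM2l ?powR_ge0//.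
    have x0 : 0 < x by exact: lt_le_trans sx.
    have : f (phi x) <= F by apply: f_ndecr; exact: phi_ndecr.
    have : g (phi x) * v x `^ q <= 0 by rewrite mulr_le0_ge0 ?powR_ge0.
    by rewrite /h; move: (g _ * _) (f _) => y z; lra.
have Fs : 0 <= F / c * s `^ c.
  by rewrite mulr_ge0 ?powR_ge0// divr_ge0 ?(ltW c0)//; exact/ltW/f_gt0.
have rcE : r `^ (c - 1) * (F / c) * r = F / c * r `^ c.
  rewrite -[X in _ * X](powRr1 (ltW r0)) mulrAC -powRD; last first.
    by apply/implyP => _; rewrite gt_eqF.
  by rewrite subrK mulrC.
rewrite -/F rcE; move: incr ys Fs.
by move: (r `^ _ * v r) (s `^ _ * v s) (F / c * s `^ c) (F / c * r `^ c) => y1 y2 y3 y4; lra.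
Qed.

(** Two barriers: kap E(phi) <= v^2 along a global solution, and v^2 <= C E(phi) in general. Each is
    verified only at points where it fails. *)
Lemma neg_global_iff : Rr = +oo%E <-> integral_diverges (integrand_ii q f g).
Proof.
have [E [iiE E0 dE damp Elow]] :=
  integrand_ii_envelope q_gt0 f_cont f_ndecr f_gt0 g_cont g_ndecr.
have E_gt0 t : 0 < t -> 0 < E t.
  move=> t0; have [k k0 hk] := Elow _ t0.
  by apply: lt_le_trans (hk t _); [rewrite mulr_gt0|rewrite ltW/=].
pose k t := (Num.sqrt (E t))^-1.
have ck t : 0 < t -> {for t, continuous k}.
  move=> /E_gt0; apply: continuous_inv_sqrt; exact: is_derive_continuous (dE t).
have k_ge0 t : 0 < t -> 0 <= k t by rewrite /k invr_ge0 sqrtr_ge0.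
have knear T : 0 < T -> exists K, forall t, 0 < t <= T -> k t <= K / Num.sqrt t.
  move=> T0; have [b b0 hb] := Elow _ T0.
  exists (Num.sqrt b)^-1 => t /andP[t0 tT].
  rewrite -invfM lef_pV2 ?posrE ?mulr_gt0 ?sqrtr_gt0 ?E_gt0//.
  by rewrite -sqrtrM ?(ltW b0)//; apply: ler_wsqrtr; apply: hb; rewrite ltW.
rewrite (@integral_diverges_eq _ _ k); last by move=> t /ltW; exact: iiE.
have [r1 [r10 r1R p1]] := phi_unbounded 0.
have E1 := E_gt0 _ p1; have v1 := v_gt0 r10 r1R.
have phi_pos r : r1 <= r -> (r%:E < Rr)%E -> 0 < phi r.
  by move=> r1r rR; apply: lt_le_trans p1 _; exact: phi_ndecr.
have dsq r : 0 < r -> (r%:E < Rr)%E -> is_derive r 1 (fun x => v x ^+ 2)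
    (2 * v r * (h r - (c - 1) / r * v r)).
  by move=> r0 rR; apply: is_derive_sqr; exact: dv.
have dEphi C r : 0 < r -> (r%:E < Rr)%E -> is_derive r 1 (fun x => C * E (phi x))
    (C * ((f (phi r) - 2 * damping q f g (phi r) * E (phi r)) * v r)).
  move=> r0 rR; apply: is_derive_scale; apply: (is_derive_chain (dE _)); exact: dphi.
split=> [Roo|div].
- have c0 : 0 < c by exact: lt_le_trans c_ge1.
  have c2 : 0 < 2 * c by exact: mulr_gt0.
  (* Chosen so that X <= 1/(2c) + L X^p: if X exceeds 1/(2c), then 2cX <= (2cX)^p. The constant
     1/(2c) is half the margin left by friction. *)
  pose L := (2 * c) `^ p / (2 * c).
  have L0 : 0 <= L by rewrite /L divr_ge0 ?powR_ge0// ltW.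
  (* The first term gives the bound at [r1]. The second gives kap (1 + L) <= 1/c: where v^2 < kap E,
     the term L X^p f costs at most L kap f / 2, so 2 v' >= kap f. *)
  pose kap := Num.min (v r1 ^+ 2 / E (phi r1)) (c * (1 + L))^-1.
  have kap0 : 0 < kap.
    by rewrite lt_min divr_gt0 ?exprn_gt0//= invr_gt0 mulr_gt0//; lra.
  have kap1 : kap * E (phi r1) <= v r1 ^+ 2 by rewrite -ler_pdivlMr// ge_min lexx.
  have kap2 : kap * (1 + L) <= c^-1.
    rewrite -ler_pdivlMr; last by lra.
    by rewrite -invfM ge_min lexx orbT.
  have lower r : r1 <= r -> kap * E (phi r) <= v r ^+ 2.
    move=> r1r; rewrite -subr_le0.
    have inR x : (x%:E < Rr)%E by rewrite Roo ltry.
    apply: (@barrier_le R (fun x => kap * E (phi x) - v x ^+ 2)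
      (fun x => kap * ((f (phi x) - 2 * damping q f g (phi x) * E (phi x)) * v x) -
        2 * v x * (h x - (c - 1) / x * v x)) r1 r r1r).
    + move=> x /andP[r1x _]; have x0 : 0 < x by exact: lt_le_trans r1x.
      by apply: is_derive_sub; [exact: dEphi|exact: dsq].
    + by rewrite subr_le0.
    move=> x /andP[/ltW r1x _]; rewrite subr_gt0 => vx2.
    have x0 : 0 < x by exact: lt_le_trans r1x.
    have vx := v_gt0 x0 (inR x); have fx := f_gt0 (phi x).
    have Ex := E_gt0 _ (phi_pos _ r1x (inR x)).
    have dmp := damp _ (ltW (phi_pos _ r1x (inR x))).
    have dm0 : 0 <= damping q f g (phi x) by exact: damping_ge0.
    have fric : (c - 1) / x * v x <= f (phi x) - c^-1 * f (phi x).
      have c10 : 0 <= c - 1 by rewrite subr_ge0.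
      have := ler_wpM2l c10 (friction_le_source x0 (inR x)).
      have -> : (c - 1) * (v x / x) = (c - 1) / x * v x by field; rewrite gt_eqF.
      by have -> : (c - 1) * (f (phi x) / c) = f (phi x) - c^-1 * f (phi x)
        by field; rewrite gt_eqF.
    have Xle : X x <= (2 * c)^-1 + L * X x `^ p.
      have [small|big] := leP (X x) (2 * c)^-1.
        by apply: le_trans small _; rewrite lerDl mulr_ge0 ?powR_ge0.
      have y1 : 1 <= 2 * c * X x by rewrite mulrC -ler_pdivrMr// div1r ltW.
      have : 2 * c * X x <= (2 * c * X x) `^ p by apply: le1r_powR => //; exact: ltW.
      rewrite powRM ?(ltW c2)// mulrC -ler_pdivlMr// => yp.
      apply: le_trans yp _; rewrite mulrAC -/L lerDr invr_ge0; exact: ltW.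
    have fX : f (phi x) * X x <= f (phi x) / (2 * c) + L * (damping q f g (phi x) * v x ^+ 2).
      rewrite damping_eq//; have := Xle; rewrite -(ler_pM2l fx).
      by rewrite mulrDr (mulrCA (f (phi x)) L).
    have dv2 : damping q f g (phi x) * v x ^+ 2 <= damping q f g (phi x) * (kap * E (phi x)).
      by rewrite ler_wpM2l// ltW.
    have dmpk : damping q f g (phi x) * (kap * E (phi x)) <= kap * f (phi x) / 2.
      by rewrite mulrCA -mulrA ler_pM2l// ler_pdivlMr//; lra.
    have LL : L * (damping q f g (phi x) * v x ^+ 2) <= L * (kap * f (phi x)) / 2.
      by rewrite -mulrA ler_wpM2l//; exact: le_trans dmpk.
    have kf : kap * f (phi x) + L * (kap * f (phi x)) <= c^-1 * f (phi x).
      rewrite (_ : _ + _ = kap * (1 + L) * f (phi x)); last by ring.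
      by rewrite ler_pM2r.
    rewrite (_ : _ - _ = v x * (kap * (f (phi x) - 2 * damping q f g (phi x) * E (phi x)) -
      2 * (h x - (c - 1) / x * v x))); last by ring.
    rewrite mulr_ge0_le0 ?(ltW vx)// subr_le0.
    have kE0 : 0 <= kap * (2 * damping q f g (phi x) * E (phi x)).
      apply: mulr_ge0; first exact: ltW.
      by apply: mulr_ge0; [exact: mulr_ge0|exact: ltW].
    have cE : f (phi x) / (2 * c) = c^-1 * f (phi x) / 2 by field; rewrite gt_eqF.
    rewrite h_eq !mulrBr mulr1; move: fX fric LL kf kE0; rewrite cE.
    move: ((c - 1) / x * v x) (f (phi x) * X x) (L * (damping q f g (phi x) * v x ^+ 2)).
    move: (kap * (2 * damping q f g (phi x) * E (phi x))) (L * (kap * f (phi x))).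
    move: (kap * f (phi x)) (c^-1 * f (phi x)) (f (phi x)).
    by move=> y1 y2 y3 y4 y5 y6 y7 y8; lra.
  apply: (@global_diverges k r1 1 (Num.sqrt kap)) => //; first by rewrite sqrtr_gt0.
  move=> r r1r; rewrite mul1r.
  have inRr : (r%:E < Rr)%E by rewrite Roo ltry.
  have r0 : 0 < r by exact: lt_le_trans r1r.
  have vr := v_gt0 r0 inRr; have Er := E_gt0 _ (phi_pos _ r1r inRr).
  rewrite /k mulrC ler_pdivlMr ?sqrtr_gt0// -sqrtrM ?(ltW kap0)//.
  by rewrite -[leRHS]ger0_norm ?(ltW vr)// -sqrtr_sqr ler_wsqrtr// lower.
(* C >= 2 matches the factor 2 in (v^2)' = 2 v v'; the other term gives the bound at [r1]. *)
- pose C := Num.max 2 (v r1 ^+ 2 / E (phi r1)).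
  have C2 : 2 <= C by rewrite le_max lexx.
  have C1 : v r1 ^+ 2 <= C * E (phi r1) by rewrite -ler_pdivrMr// le_max lexx orbT.
  have upper r : r1 <= r -> (r%:E < Rr)%E -> v r ^+ 2 <= C * E (phi r).
    move=> r1r rR; rewrite -subr_le0.
    apply: (@barrier_le R (fun x => v x ^+ 2 - C * E (phi x))
      (fun x => 2 * v x * (h x - (c - 1) / x * v x) -
        C * ((f (phi x) - 2 * damping q f g (phi x) * E (phi x)) * v x)) r1 r r1r).
    + move=> x /andP[r1x xr]; have x0 : 0 < x by exact: lt_le_trans r1x.
      have xR := sub_lt xr rR.
      by apply: is_derive_sub; [exact: dsq|exact: dEphi].
    + by rewrite subr_le0.
    move=> x /andP[/ltW r1x /ltW xr]; rewrite subr_gt0 => vx2.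
    have x0 : 0 < x by exact: lt_le_trans r1x.
    have xR := sub_lt xr rR.
    have vx := v_gt0 x0 xR; have fx := f_gt0 (phi x).
    have dmp := damp _ (ltW (phi_pos _ r1x xR)).
    have dm0 : 0 <= damping q f g (phi x) by exact: damping_ge0.
    have fric := friction_ge0 x0 xR.
    rewrite (_ : _ - _ = v x * (2 * (h x - (c - 1) / x * v x) -
      C * (f (phi x) - 2 * damping q f g (phi x) * E (phi x)))); last by ring.
    rewrite mulr_ge0_le0 ?(ltW vx)// subr_le0.
    have C0 : 0 <= C by lra.
    (* For X <= 1, X^p <= X compares the two damping terms. For X > 1 the source is nonpositive, so
       v' <= 0 whereas E' >= 0. *)
    have [X1|X1] := leP (X x) 1.
      have XpX : X x `^ p <= X x.
        have [X0|X0] := eqVneq (X x) 0.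
          by rewrite X0 powR0// gt_eqF// (lt_le_trans _ p_ge1).
        by apply: ge1r_powR => //; rewrite X1 lt_neqAle eq_sym X0 X_ge0.
      have fX : damping q f g (phi x) * v x ^+ 2 <= f (phi x) * X x.
        by rewrite damping_eq// ler_pM2l.
      have dC : damping q f g (phi x) * (C * E (phi x)) <= damping q f g (phi x) * v x ^+ 2.
        by rewrite ler_wpM2l// ltW.
      have Cf : 2 * f (phi x) <= C * f (phi x) by rewrite ler_pM2r.
      rewrite h_eq !mulrBr mulr1.
      rewrite (_ : C * (2 * damping q f g (phi x) * E (phi x)) =
        2 * (damping q f g (phi x) * (C * E (phi x)))); last by ring.
      move: fX dC Cf fric.
      move: (f (phi x) * X x) (damping q f g (phi x) * v x ^+ 2) (C * f (phi x)).
      move: ((c - 1) / x * v x) (damping q f g (phi x) * (C * E (phi x))) (f (phi x)).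
      by move=> y1 y2 y3 y4 y5 y6; lra.
    have h0 : h x <= 0 by rewrite h_eq mulr_ge0_le0 ?(ltW fx)//; lra.
    apply: (@le_trans _ _ 0); last by rewrite mulr_ge0// subr_ge0.
    by rewrite mulr_ge0_le0//; lra.
  apply: (@diverges_global k r1 (Num.sqrt C)) => //.
  move=> r r1r rR; have r0 : 0 < r by exact: lt_le_trans r1r.
  have vr := v_gt0 r0 rR; have Er := E_gt0 _ (phi_pos _ r1r rR).
  rewrite /k mulrC ler_pdivrMr ?sqrtr_gt0// -sqrtrM; last by lra.
  by rewrite -[leLHS]ger0_norm ?(ltW vr)// -sqrtr_sqr ler_wsqrtr// upper.
Qed.

End NegativeSource.

End Cases.

(** * Source bounded above by a negative constant *)

Section BoundedAwayNegative.
Context {R : realType} (q : R) (f g : R -> R).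
Context (q_gt0 : 0 < q) (q_le2 : q <= 2).
Context (f_cont : continuous f) (f_ndecr : {homo f : x y / x <= y}).
Context (f_gt0 : forall t, 0 < f t).
Context (g_cont : continuous g) (g_ndecr : {homo g : x y / x <= y}).
Implicit Types (s t x y : R).

Lemma powR_div x y b : 0 <= x -> 0 < y -> (x / y) `^ b = x `^ b / y `^ b.
Proof.
move=> x0 y0; have xy0 : 0 <= x / y by rewrite divr_ge0// ltW.
have yn0 : y != 0 by rewrite gt_eqF.
have -> : x `^ b = (x / y) `^ b * y `^ b by rewrite -powRM ?(ltW y0)// divfK.
by rewrite mulfK// gt_eqF// powR_gt0.
Qed.

Lemma sqr_powR_inv x : 0 <= x -> (x `^ q^-1) ^+ 2 = x `^ (2 / q).
Proof.
by move=> x0; rewrite -powR_mulrn ?powR_ge0// -powRrM mulrC.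
Qed.

Lemma integrand_iii_continuous t : 0 < t -> {for t, continuous (integrand_iii q f)}.
Proof.
move=> t0; apply: continuous_add.
  apply: continuous_inv_sqrt; last by rewrite mulr_gt0.
  by apply: continuous_mul; [exact: continuous_ident|exact: f_cont].
apply: continuous_inv; first by rewrite gt_eqF// powR_gt0.
by apply: continuous_powR_gt0; [exact: f_cont|exact: f_gt0].
Qed.

Lemma integrand_iii_ge0 t : 0 <= integrand_iii q f t.
Proof. by rewrite addr_ge0 ?invr_ge0 ?sqrtr_ge0 ?powR_ge0. Qed.

(** Above, E(t) <= t f(t), and 2 damping E <= f gives the other bound. Below, E(2t) is estimated
    from its growth on [t, 2t]. As d <= g^- <= g^-(0) for t >= 0, the function g^- may be replaced
    by constants. *)
Lemma diverges_ii_iii_iff (d : R) : 0 < d -> (forall t, g t <= - d) ->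
  integral_diverges (integrand_ii q f g) <-> integral_diverges (integrand_iii q f).
Proof.
move=> d0 gd.
have [E [iiE E0 dE damp Elow]] := integrand_ii_envelope q_gt0 f_cont f_ndecr f_gt0 g_cont g_ndecr.
have E_gt0 t : 0 < t -> 0 < E t.
  move=> t0; have [k k0 hk] := Elow _ t0.
  by apply: lt_le_trans (hk t _); [rewrite mulr_gt0|rewrite ltW/=].
have E_ge0 t : 0 <= t -> 0 <= E t.
  by rewrite le_eqVlt => /predU1P[<-|/E_gt0/ltW//]; rewrite E0.
pose k t := (Num.sqrt (E t))^-1.
have ck t : 0 < t -> {for t, continuous k}.
  move=> /E_gt0; apply: continuous_inv_sqrt; exact: is_derive_continuous (dE t).
have k_ge0 t : 0 < t -> 0 <= k t by rewrite /k invr_ge0 sqrtr_ge0.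
rewrite (@integral_diverges_eq _ _ k); last by move=> t /ltW; exact: iiE.
have negpE t : negp g t = - g t by rewrite /negp max_l// oppr_ge0 (le_trans (gd t))// oppr_le0 ltW.
have dG t : d <= negp g t by rewrite negpE lerNr.
have G_gt0 t : 0 < negp g t by exact: lt_le_trans (dG t).
have dm_gt0 t : 0 < damping q f g t by rewrite /damping mulr_gt0// powR_gt0// divr_gt0.
have fq_gt0 t : 0 < f t `^ q^-1 by exact: powR_gt0.
have p_ge0 : 0 <= 2 / q by rewrite divr_ge0// ltW.
have q_ge0 : 0 <= q^-1 by rewrite invr_ge0 ltW.
split.
(* [B] comes from g^- <= g^-(0) on the positive half-line. *)
- pose B := negp g 0 `^ q^-1; have B0 : 0 <= B by exact: powR_ge0.
  apply: (@diverges_scaled_le R k (integrand_iii q f) 2 (2 + 2 * B)) => //; first by lra.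
    by move=> t t0; exact: integrand_iii_continuous.
    by move=> t _; exact: integrand_iii_ge0.
  move=> t t0; have t2 : 0 < 2 * t by lra.
  (* If E(2t) were below Y/2, then on [t, 2t] the damping term would take at most half of f(t). So
     E' >= f(t)/2, and E would gain t f(t)/2 >= Y/2 there. *)
  have Y_le : Num.min (t * f t) (f t / (2 * damping q f g t)) <= 2 * E (2 * t).
    set Y := Num.min _ _; rewrite leNgt; apply/negP => EY.
    have Y1 : Y <= t * f t by rewrite ge_min lexx.
    have Y2 : 2 * damping q f g t * Y <= f t.
      rewrite mulrC -ler_pdivlMr; last by rewrite pmulr_rgt0.
      by rewrite /Y ge_min lexx orbT.
    have tt : t <= 2 * t by lra.
    have : f t / 2 * (2 * t) - f t / 2 * t <= E (2 * t) - E t.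
      apply: (@derive_le_increment R (fun s => f t / 2 * s) (fun=> f t / 2 * 1)
        E (fun s => f s - 2 * damping q f g s * E s) t (2 * t) tt).
      move=> s /andP[ts s2t]; have s0 : 0 < s by exact: lt_trans ts.
      have Es : E s <= E (2 * t).
        apply: (derive_nonneg_le (ltW s2t) (fun z _ => dE z)) => z /andP[sz _].
        by rewrite subr_ge0; apply: damp; rewrite ltW// (lt_trans s0).
      have dms : damping q f g s <= damping q f g t.
        by apply: damping_nincr => //; exact: ltW.
      have dE' : damping q f g s * E s <= damping q f g t * (Y / 2).
        apply: ler_pM => //; [exact/ltW/dm_gt0|exact/ltW/E_gt0|].
        by apply: le_trans Es _; rewrite ler_pdivlMr// mulrC ltW.
      have fts : f t <= f s by apply: f_ndecr; exact: ltW.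
      rewrite mulr1 -mulrA; move: dE' Y2 fts.
      rewrite -mulrA mulrA.
      move: (damping q f g s * E s) (f t) (f s) => y1 y2 y3.
      rewrite -mulrA; move: (damping q f g t) => y4.
      by rewrite !mulrA => *; lra.
    have := E_ge0 _ (ltW t0); rewrite mulrC in Y1.
    by move: (f t) (E t) (E (2 * t)) Y1 EY => y1 y2 y3 Y1 EY y20 H; lra.
  have E2 := E_gt0 _ t2; have sE : 0 < Num.sqrt (E (2 * t)) by rewrite sqrtr_gt0.
  have tf0 : 0 < t * f t by rewrite mulr_gt0.
  have i1 : 0 <= (Num.sqrt (t * f t))^-1 by rewrite invr_ge0 sqrtr_ge0.
  have i2 : 0 <= (f t `^ q^-1)^-1 by rewrite invr_ge0 ltW.
  have Bi1 : 0 <= B * (Num.sqrt (t * f t))^-1 by exact: mulr_ge0.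
  have Bi2 : 0 <= B * (f t `^ q^-1)^-1 by exact: mulr_ge0.
  suff : k (2 * t) <= 2 * (Num.sqrt (t * f t))^-1 \/
         k (2 * t) <= 2 * (B * (f t `^ q^-1)^-1).
    rewrite /integrand_iii; move: Bi1 Bi2 i1 i2.
    move: (Num.sqrt _)^-1 (f t `^ q^-1)^-1 (k _) => y1 y2 y3.
    by move=> h1 h2 h3 h4 [] h5; rewrite mulrDl !mulrDr -!mulrA; lra.
  move: Y_le; rewrite ge_min => /orP[Y1|Y2]; [left|right].
    have s1 : Num.sqrt (t * f t) <= 2 * Num.sqrt (E (2 * t)).
      rewrite -ler_sqr ?nnegrE ?mulr_ge0 ?sqrtr_ge0// exprMn !sqr_sqrtr ?(ltW tf0) ?(ltW E2)//.
      by move: (t * f t) (E _) Y1 E2 => y1 y2; lra.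
    by rewrite /k ler_pdivlMr ?sqrtr_gt0// mulrC ler_pdivrMr.
  pose u := (negp g t / f t) `^ q^-1; have u0 : 0 <= u by exact: powR_ge0.
  have u2 : u ^+ 2 = (negp g t / f t) `^ (2 / q) by rewrite sqr_powR_inv// divr_ge0// ltW.
  have uB : u <= B * (f t `^ q^-1)^-1.
    rewrite /u powR_div ?(ltW (G_gt0 _))// ler_wpM2r//.
    apply: ge0_ler_powR => //; rewrite ?nnegrE ?(ltW (G_gt0 _))//.
    by apply: negp_nincr => //; exact: ltW.
  have u_le : 1 <= 2 * u * Num.sqrt (E (2 * t)).
    rewrite -ler_sqr ?nnegrE ?mulr_ge0 ?sqrtr_ge0// expr1n !exprMn u2 sqr_sqrtr ?(ltW E2)//.
    have dm2 : 0 < 2 * damping q f g t by rewrite pmulr_rgt0.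
    rewrite (ler_pdivrMr _ _ dm2) in Y2.
    rewrite -(ler_pM2r (f_gt0 t)) mul1r; apply: le_trans Y2 _.
    by rewrite /damping le_eqVlt; apply/orP; left; apply/eqP; ring.
  apply: (@le_trans _ _ (2 * u)); last by rewrite ler_pM2l.
  by rewrite /k -[leLHS]mul1r ler_pdivrMr.
(* [A] comes from g^- >= d, which turns the bound of E by (f/g^-)^(2/q) into one by (f/d)^(2/q). *)
- pose A := (d `^ q^-1)^-1; have dq0 : 0 < d `^ q^-1 by exact: powR_gt0.
  have A0 : 0 <= A by rewrite invr_ge0 ltW.
  apply: (@diverges_scaled_le R (integrand_iii q f) k 1 (1 + A)) => //.
  + by rewrite ltr_pwDl.
  + by move=> t t0; exact: integrand_iii_continuous.
  + by move=> t _; exact: integrand_iii_ge0.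
  move=> t t0; rewrite mul1r /integrand_iii mulrDl mul1r.
  have Et := E_gt0 _ t0; have sE : 0 < Num.sqrt (E t) by rewrite sqrtr_gt0.
  have ft := f_gt0 t; apply: lerD.
    rewrite /k lef_pV2 ?posrE ?sqrtr_gt0 ?mulr_gt0//; apply: ler_wsqrtr.
    have : E t - E 0 <= f t * t - f t * 0.
      apply: (@derive_le_increment R E (fun s => f s - 2 * damping q f g s * E s)
        (fun s => f t * s) (fun=> f t * 1) 0 t (ltW t0)).
      move=> s /andP[s0 st]; rewrite mulr1.
      have fst : f s <= f t by apply: f_ndecr; exact: ltW.
      apply: le_trans fst; rewrite gerBl.
      by apply: mulr_ge0; [apply: mulr_ge0 => //; exact: ltW|exact/ltW/E_gt0].
    by rewrite E0 mulr0 !subr0 mulrC.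
  rewrite /k /A -invfM lef_pV2 ?posrE ?mulr_gt0//.
  rewrite -ler_sqr ?nnegrE ?mulr_ge0 ?sqrtr_ge0 ?(ltW dq0) ?(ltW (fq_gt0 _))//.
  rewrite exprMn sqr_sqrtr ?(ltW Et)// !sqr_powR_inv ?(ltW d0) ?(ltW ft)//.
  have : 2 * damping q f g t * E t <= f t by apply: damp; exact: ltW.
  have dd : (d / f t) `^ (2 / q) <= (negp g t / f t) `^ (2 / q).
    apply: ge0_ler_powR => //; rewrite ?nnegrE ?divr_ge0 ?(ltW (G_gt0 _)) ?(ltW d0) ?(ltW ft)//.
    by rewrite ler_wpM2r// invr_ge0 ltW.
  rewrite powR_div ?(ltW d0)// in dd.
  have fp0 : 0 < f t `^ (2 / q) by exact: powR_gt0.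
  rewrite ler_pdivrMr// in dd.
  have -> : 2 * damping q f g t * E t = (2 * (negp g t / f t) `^ (2 / q) * E t) * f t.
    by rewrite /damping; ring.
  rewrite -[leRHS]mul1r ler_pM2r// => G1.
  apply: (@le_trans _ _ ((negp g t / f t) `^ (2 / q) * f t `^ (2 / q) * E t)).
    by rewrite ler_wpM2r// ltW.
  rewrite mulrAC ler_piMl ?(ltW fp0)//; apply: le_trans G1.
  rewrite -mulrA ler_peMl//; first by rewrite mulr_ge0 ?powR_ge0// ltW.
  by rewrite ler1n.
Qed.

End BoundedAwayNegative.

Theorem theorem2p5 (R : realType) (q c : R) (f g : R -> R) (a : R)
  (phi : R -> R) (Rr : \bar R) :
  0 < q -> q <= 2 -> 1 <= c ->
  continuous f -> {homo f : x y / x <= y} -> (forall t, 0 < f t) ->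
  continuous g -> {homo g : x y / x <= y} ->
  is_maximal_solution q c f g a phi Rr ->
  ((exists l : \bar R, (g t)%:E @[t --> +oo] --> l /\ (0 < l)%E) ->
     (Rr = +oo%E <-> (q <= 1 /\ integral_diverges (integrand_i q f g)))) /\
  ((exists l : \bar R, (g t)%:E @[t --> +oo] --> l /\ (l <= 0)%E) ->
     (Rr = +oo%E <-> integral_diverges (integrand_ii q f g))) /\
  ((exists l : \bar R, (g t)%:E @[t --> +oo] --> l /\ (l < 0)%E) ->
     (integral_diverges (integrand_ii q f g) <->
      integral_diverges (integrand_iii q f))).
Proof.
move=> q0 q2 c1 cf mf f0 cg mg maxi; split; [|split] => -[l [gl l0]].
- have [tg gtg] := limit_gt0_exists gl l0; split=> [Roo|[q1]].
    split; first exact: (global_pos_exponent_le1 q0 q2 c1 cf mf f0 cg mg maxi gtg Roo).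
    exact: (global_pos_diverges q0 q2 c1 cf mf f0 cg mg maxi gtg Roo).
  exact: (diverges_global_pos q0 q2 c1 cf mf f0 cg mg maxi gtg q1).
- apply: (neg_global_iff q0 q2 c1 cf mf f0 cg mg maxi) => t; rewrite -lee_fin.
  exact: le_trans (le_limit mg t gl) l0.
- case: l gl l0 => [l| |] gl l0.
  + apply: (@diverges_ii_iii_iff _ _ _ _ q0 q2 cf mf f0 cg mg (- l)).
      by rewrite oppr_gt0 -lte_fin.
    by move=> t; rewrite opprK -lee_fin; exact: le_limit gl.
  + by [].
  (* The limit cannot be minus infinity, since the finite value g(0) lies below it. *)
  + by have := le_limit mg 0 gl.
Qed.
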